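(* Let $\varepsilon=1$. Assume that the charged-particle system $\ddot x=\dot x\times B(x)+F(x)$ on $[0,T]$ has sufficiently smooth solutions, that the functions $A(x)$ and $F(x)$ are sufficiently differentiable, and that $A$ and $F$ are locally Lipschitz continuous with Lipschitz constants $L$. Let $x_n,v_n$ be the approximations produced by the filtered two-step variational integrator FVI with stepsize $h$. Then there exists a constant $h_0>0$ such that, if the stepsize satisfies $h\le h_0$ and $|\cos(h/2)|\ge c>0$, the global errors satisfy $$|x_{n+1}-x(t_{n+1})|\le Ch^2,\qquad |v_{n+1}-v(t_{n+1})|\le Ch^2\qquad\text{for } nh\le T,$$ where $C>0$ is a generic constant independent of $h$ and $n$ but depending on $L$ and $T$.
   Context: System ($\varepsilon=1$): $\ddot x(t)=\dot x(t)\times B(x(t))+F(x(t))$, $t\in[0,T]$, $x(t)\in\mathbb{R}^3$, $v:=\dot x$, with $B(x)=B_0+B_1(x)$, where $B_0\in\mathbb{R}^3$ is a fixed vector with $|B_0|=1$ ($|\cdot|$ is the Euclidean norm), $B_1:\mathbb{R}^3\to\mathbb{R}^3$ is a non-constant magnetic field with known vector potential $A_1$, and $F:\mathbb{R}^3\to\mathbb{R}^3$; $B_1$ and $F$ are smooth and bounded. The full vector potential is $A(x)=-\tfrac12 x\times B_0+A_1(x)$, so $B=\nabla_x\times A$. $A'(x)=(\partial_jA_i(x))_{i,j=1}^3$ is the Jacobian. The initial data satisfy $|x(0)|\le\hat C$, $|\dot x(0)|\le\hat C$. Filters: $\tilde B_0$ is the skew-symmetric matrix with $-\tilde B_0v=v\times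 B_0$ for all $v\in\mathbb{R}^3$; $\operatorname{tanc}(\zeta)=\tan(\zeta)/\zeta$, $\operatorname{sinc}(\zeta)=\sin(\zeta)/\zeta$; $$\Psi=I+\big(1-\operatorname{tanc}(\tfrac h2)\big)\tilde B_0^2,\qquad \Phi=I+\big(1-\operatorname{sinc}(\tfrac h2)^{-1}\big)\tilde B_0^2 .$$ Method FVI: $t_n=nh$, $x_0=x(0)$, $v_0=\dot x(0)$, $x_{n\pm1/2}:=(x_n+x_{n\pm1})/2$, and for $n\ge1$ $$x_{n+1}-2x_n+x_{n-1}=\Psi\Big(\tfrac h2A'(x_{n+1/2})^{\intercal}(x_{n+1}-x_n)+\tfrac h2A'(x_{n-1/2})^{\intercal}(x_n-x_{n-1})-h\big(A(x_{n+1/2})-A(x_{n-1/2})\big)+\tfrac{h^2}2\big(F(x_{n+1/2})+F(x_{n-1/2})\big)\Big).$$ The starting value $x_1$ is defined by $x_1=x_0+h\Psi\big(p_0+\tfrac12A'(x_{1/2})^{\intercal}(x_1-x_0)-A(x_{1/2})+\tfrac h2F(x_{1/2})\big)$ with $p_0=v_0+A(x_0)$ and $x_{1/2}=(x_0+x_1)/2$. The velocities are defined for $n\ge0$ by $\dfrac{v_{n+1}+v_n}{2}=\Phi\,\dfrac{x_{n+1}-x_n}{h}$.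
   Formalization: The implicit equations of FVI can have spurious solutions with unbounded steps, for which the bounds fail; the approximations are therefore required to satisfy |x_{n+1}-x_n| ≤ r for nh ≤ T, with r>0 arbitrary and fixed before h_0 and C. *)

(* Defs.v *)
(* Vectors of R^3 are column vectors 'cV[R]_3, indexed from 0. *)
From HB Require Import structures.
From mathcomp Require Import all_boot all_order all_algebra.
From mathcomp Require Import ring.
From mathcomp Require Import all_classical all_reals all_analysis.
Set Implicit Arguments.
Unset Strict Implicit.
Unset Printing Implicit Defensive.
Import Order.TTheory GRing.Theory Num.Theory.
Import numFieldNormedType.Exports.
Local Open Scope classical_set_scope.
Local Open Scope ring_scope.

(* The library's norm on matrices is the sup norm, hence this definition. *)
Definition enorm (R : realType) (v : 'cV[R]_3) : R :=
  Num.sqrt (\sum_(i < 3) v i 0 ^+ 2).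

(* Indices are in Z/3Z, so i + 1 and i + 2 are the cyclic successors of i. *)
Definition cross (R : realType) (u v : 'cV[R]_3) : 'cV[R]_3 :=
  \col_(i < 3) (u (i + 1) 0 * v (i + 2) 0 - u (i + 2) 0 * v (i + 1) 0).

Definition partial (R : realType) (j : 'I_3) (f : 'cV[R]_3 -> 'cV[R]_3)
    (x : 'cV[R]_3) : 'cV[R]_3 :=
  'D_(delta_mx j 0) f x.

(* Entry (i, j) is the j-th partial derivative of the i-th component; the
   library's jacobian is the transpose and is restricted to row vectors. *)
Definition Jac (R : realType) (f : 'cV[R]_3 -> 'cV[R]_3) (x : 'cV[R]_3) :
    'M[R]_3 :=
  \matrix_(i < 3, j < 3) partial j f x i 0.

Definition curl (R : realType) (f : 'cV[R]_3 -> 'cV[R]_3) (x : 'cV[R]_3) :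
    'cV[R]_3 :=
  \col_(i < 3) (partial (i + 1) f x (i + 2) 0 - partial (i + 2) f x (i + 1) 0).

(* C^k on the whole space V; directional derivatives in finitely many
   independent directions would suffice when V is finite-dimensional. *)
Fixpoint Ck (R : realType) (V W : normedModType R) (k : nat) (f : V -> W) :
    Prop :=
  match k with
  | 0 => continuous f
  | k'.+1 => (forall x, differentiable f x) /\
             (forall v, Ck k' (fun x => 'D_v f x))
  end.

Definition bounded_field (R : realType) (f : 'cV[R]_3 -> 'cV[R]_3) : Prop :=
  exists M : R, forall x, enorm (f x) <= M.

(* L rho is a Lipschitz constant on the closed ball of radius rho. *)
Definition locally_lipschitz (R : realType) (L : R -> R)
    (f : 'cV[R]_3 -> 'cV[R]_3) : Prop :=
  forall (rho : R) (y z : 'cV[R]_3), enorm y <= rho -> enorm z <= rho ->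
    enorm (f y - f z) <= L rho * enorm (y - z).

Definition potential (R : realType) (B0 : 'cV[R]_3)
    (A1 : 'cV[R]_3 -> 'cV[R]_3) (x : 'cV[R]_3) : 'cV[R]_3 :=
  - (2^-1 *: cross x B0) + A1 x.

(* x is defined on all of R so that two-sided derivatives make sense at 0 and T:
   the equation is only imposed on [0, T], and beyond T the function x is an
   arbitrary smooth continuation of the solution. *)
Definition solves_CPD (R : realType) (T : R) (B F : 'cV[R]_3 -> 'cV[R]_3)
    (x : R -> 'cV[R]_3) : Prop :=
  forall t : R, 0 <= t <= T ->
    derive1n 2 x t = cross (derive1 x t) (B (x t)) + F (x t).

Definition Btilde (R : realType) (B0 : 'cV[R]_3) : 'M[R]_3 :=
  \matrix_(i < 3, j < 3) - cross (delta_mx j 0) B0 i 0.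

(* This identity determines the matrix Btilde B0, which is therefore the matrix
   v |-> B0 x v and is skew-symmetric. *)
Lemma BtildeE (R : realType) (B0 v : 'cV[R]_3) :
  - (Btilde B0 *m v) = cross v B0.
Proof.
apply/matrixP => i j; rewrite ord1 !mxE.
rewrite (bigD1 i) // (bigD1 (i + 1)) /=; last first.
  by rewrite -subr_eq0 addrC addKr.
rewrite (bigD1 (i + 2)) /=; last by case: i => [[|[|[|//]]] Hi].
rewrite big1 => [|k]; last first.
  by case: i k => [[|[|[|//]]] Hi] [[|[|[|//]]] Hk].
rewrite !mxE !eqxx /=.
have -> : (i + 1 == i) = false by case: i => [[|[|[|//]]] Hi].
have -> : (i + 2 == i) = false by case: i => [[|[|[|//]]] Hi].
have -> : (i + 2 == i + 1) = false by case: i => [[|[|[|//]]] Hi].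
have -> : (i + 1 == i + 2) = false by case: i => [[|[|[|//]]] Hi].
by rewrite /=; ring.
Qed.

Definition tanc (R : realType) (z : R) : R := tan z / z.
Definition sinc (R : realType) (z : R) : R := sin z / z.

Definition Psi (R : realType) (B0 : 'cV[R]_3) (h : R) : 'M[R]_3 :=
  1%:M + (1 - tanc (h / 2)) *: (Btilde B0 *m Btilde B0).

Definition Phi (R : realType) (B0 : 'cV[R]_3) (h : R) : 'M[R]_3 :=
  1%:M + (1 - (sinc (h / 2))^-1) *: (Btilde B0 *m Btilde B0).

Definition midpoint (R : realType) (y z : 'cV[R]_3) : 'cV[R]_3 :=
  2^-1 *: (y + z).

Definition FVI_start (R : realType) (B0 : 'cV[R]_3)
    (A F : 'cV[R]_3 -> 'cV[R]_3) (h : R) (x0 v0 x1 : 'cV[R]_3) : Prop :=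
  let p0 := v0 + A x0 in
  let xh := midpoint x0 x1 in
  x1 = x0 + h *: (Psi B0 h *m
    (p0 + 2^-1 *: ((Jac A xh)^T *m (x1 - x0)) - A xh + (h / 2) *: F xh)).

(* One step of the two-step formula, with xm, x, xp for x_{n-1}, x_n, x_{n+1}. *)
Definition FVI_step (R : realType) (B0 : 'cV[R]_3)
    (A F : 'cV[R]_3 -> 'cV[R]_3) (h : R) (xm x xp : 'cV[R]_3) : Prop :=
  let yp := midpoint x xp in
  let ym := midpoint x xm in
  xp - 2 *: x + xm = Psi B0 h *m
    ((h / 2) *: ((Jac A yp)^T *m (xp - x))
     + (h / 2) *: ((Jac A ym)^T *m (x - xm))
     - h *: (A yp - A ym)
     + (h ^+ 2 / 2) *: (F yp + F ym)).

Definition FVI_velocity (R : realType) (B0 : 'cV[R]_3) (h : R)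
    (x xp v vp : 'cV[R]_3) : Prop :=
  2^-1 *: (vp + v) = Phi B0 h *m (h^-1 *: (xp - x)).

(* Approximations x_0, ..., x_{N+1} and v_0, ..., v_{N+1}, N being the largest
   n with n h <= T; later terms of the sequences are irrelevant. *)
Definition FVI (R : realType) (B0 : 'cV[R]_3) (A F : 'cV[R]_3 -> 'cV[R]_3)
    (T h : R) (x0 v0 : 'cV[R]_3) (x v : nat -> 'cV[R]_3) : Prop :=
  [/\ x 0%N = x0, v 0%N = v0,
      FVI_start B0 A F h (x 0%N) (v 0%N) (x 1%N),
      forall n : nat, (0 < n)%N -> n%:R * h <= T ->
        FVI_step B0 A F h (x n.-1) (x n) (x n.+1)
    & forall n : nat, n%:R * h <= T ->
        FVI_velocity B0 h (x n) (x n.+1) (v n) (v n.+1)].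

(* The equation for x_{n+1} is implicit and, for fields that are only locally
   Lipschitz, it can have spurious solutions whose distance to x_n is unbounded
   as h -> 0. The iterates are those obtained by solving it within distance r of x_n. *)
Definition solved_within (R : realType) (r T h : R) (x : nat -> 'cV[R]_3) :
    Prop :=
  forall n : nat, n%:R * h <= T -> enorm (x n.+1 - x n) <= r.

(* Main.v *)
Require Import Defs.
From HB Require Import structures.
From mathcomp Require Import all_boot all_order all_algebra.
From mathcomp Require Import ring lra.
From mathcomp Require Import all_classical all_reals all_analysis.
Import Order.TTheory GRing.Theory Num.Theory.
Import numFieldNormedType.Exports.
Local Open Scope classical_set_scope.
Local Open Scope ring_scope.

Set Implicit Arguments.
Unset Strict Implicit.
Unset Printing Implicit Defensive.

(** For small [h] the filters are the identity up to O(h^2), so the method is a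
perturbation of a symmetric two-step scheme, and it converges because it is
consistent and stable.  All estimates are made in the sup norm, which is
equivalent to the Euclidean one.

Consistency.  The scheme is symmetric under [h -> - h].  Inserting the exact
solution, every group of terms in the two-step formula is an even or an odd
function of [h] about [t], so it equals its leading term up to two further
powers of [h] ([smooth_bounds], [trajectory_expansion], [uO_midpoint_rule],
[uO_sym_mean]).  The leading term of the right-hand side is
h^2 (A'^T v - A' v + F) = h^2 (v x curl A + F) = h^2 x'' ([lorentz_curl],
[curl_potential]), hence the two-step formula has defect O(h^4)
([two_step_defect]).  The starting formula is one-sided and has defect O(h^3)
([start_defect]), enough because it is used once.

Stability.  Let e_n = x_n - x(t_n) and d_n = (e_(n+1) - e_n) / h.  Both A' and
the second difference of A are Lipschitz on balls, and the right-hand side of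
the scheme carries a factor [h] ([FVI_rhs_stability]); with the defect this gives
|d_(n+1) - d_n| <= K h (|d_(n+1)| + |d_n| + |e_(n+1)|) + K h^3, while
|e_(n+1)| <= |e_n| + h |d_n|.  A discrete Gronwall inequality for |e_n| + |d_n|
([gronwall], [error_step]) then yields O(h^2).  The Lipschitz constants are those
of the ball of radius M + 1 + r, where M bounds the exact solution: errors at
most 1 at x_n and x_(n+1) and a step of length at most r keep x_(n+2) in it, and
the O(h^2) bound itself keeps the errors below 1 when [h] is small.

Velocities.  The recursion v_(n+1) = 2 Phi (x_(n+1) - x_n) / h - v_n does not
damp errors, and adding up its O(h^2) defects would lose a power of [h].
Comparing v_(n+2) with v_n instead, consecutive defects cancel to O(h^3)
([velocity_defect]), and the contribution of the positions is
2 Phi (d_(n+1) - d_n) = O(h^3); the sum over T / h steps is O(h^2)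
([discrete_convergence]). *)

(** * Smooth maps between normed modules *)

Section smooth_maps.
Context {R : realType}.

Definition iter_derive {V W : normedModType R} (w : V) (j : nat) (f : V -> W) :=
  iter j (fun (g : V -> W) y => 'D_w g y) f.

Lemma Ck_differentiable (V W : normedModType R) k (f : V -> W) :
  Ck k.+1 f -> forall y, differentiable f y.
Proof. by move=> /= []. Qed.

Lemma Ck_derive (V W : normedModType R) k (f : V -> W) v :
  Ck k.+1 f -> Ck k (fun y => 'D_v f y).
Proof. by move=> /= []. Qed.

Lemma Ck_continuous (V W : normedModType R) k (f : V -> W) :
  Ck k f -> continuous f.
Proof.
by case: k => [//|k] /Ck_differentiable df y; exact: differentiable_continuous.
Qed.

Lemma CkW (V W : normedModType R) k (f : V -> W) : Ck k.+1 f -> Ck k f.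
Proof.
elim: k f => [|k IH] f Hf; first exact: Ck_continuous Hf.
by split=> [y|v]; [exact: Ck_differentiable Hf y|apply/IH/Ck_derive].
Qed.

Lemma Ck_le (V W : normedModType R) j k (f : V -> W) :
  (j <= k)%N -> Ck k f -> Ck j f.
Proof.
elim: k => [|k IH]; first by rewrite leqn0 => /eqP ->.
by rewrite leq_eqVlt => /orP[/eqP -> //|jk] /CkW; exact: IH.
Qed.

(** A basis with coordinate functions of norm at most 1, and compact closed balls:
what is needed to turn the continuity of finitely many partial derivatives into
a bound for derivatives in all directions.  It covers both the space of the
fields ([col_frame]) and the time axis ([real_frame]). *)
Definition finite_frame {V : normedModType R} m (e : 'I_m -> V)
    (co : 'I_m -> V -> R) : Prop :=
  [/\ forall w, w = \sum_j co j w *: e j,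
      forall j w, `|co j w| <= `|w|
    & forall rho : R, compact [set y : V | `|y| <= rho]].

Lemma derive_frame (V W : normedModType R) m (e : 'I_m -> V) co (f : V -> W)
    (w y : V) : finite_frame e co -> differentiable f y ->
  'D_w f y = \sum_j co j w *: 'D_(e j) f y.
Proof.
move=> [we _ _] df; rewrite deriveE// {1}(we w) linear_sum.
by apply: eq_bigr => j _; rewrite linearZ deriveE.
Qed.

Lemma iter_derive_sum (V W : normedModType R) (w : V) j m (a : 'I_m -> R)
    (g : 'I_m -> V -> W) : (forall i, Ck j (g i)) ->
  iter_derive w j (fun y => \sum_i a i *: g i y) =
  (fun y => \sum_i a i *: iter_derive w j (g i) y).
Proof.
elim: j g => [//|j IH] g Hg; rewrite /iter_derive iterSr.
rewrite [X in iter j _ X](_ : _ = fun y => \sum_i a i *: 'D_w (g i) y); last first.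
  apply/funext => y.
  rewrite (_ : (fun z => _) = \sum_i (a i \*: g i)); last first.
    by apply/funext => z; rewrite fct_sumE.
  rewrite derive_sum => [|i]; last first.
    by apply/derivableZ/diff_derivable/(Ck_differentiable (Hg i)).
  apply: eq_bigr => i _; rewrite deriveZ//.
  exact/diff_derivable/(Ck_differentiable (Hg i)).
rewrite -/(iter_derive w j _) IH => [|i]; last exact: Ck_derive.
by apply/funext => y; apply: eq_bigr => i _; rewrite /iter_derive iterSr.
Qed.

(** By linearity in the direction, D_w = sum_i w_i D_(e_i); each step of the
induction peels off one derivative along a fixed basis vector, so that in the end
only continuous functions on a compact ball have to be bounded. *)
Lemma iter_derive_bounded (V W : normedModType R) m (e : 'I_m -> V) co j
    (f : V -> W) (rho : R) : finite_frame e co -> Ck j f ->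
  exists2 K, 0 <= K &
    forall y w, `|y| <= rho -> `|iter_derive w j f y| <= K * `|w| ^+ j.
Proof.
move=> fr; elim: j f => [|j IH] f Hf.
  have /compact_bounded[M [Mr HM]] : compact (f @` [set y | `|y| <= rho]).
    apply: continuous_compact; last by case: fr.
    exact/continuous_subspaceT/(Ck_continuous Hf).
  exists (`|M| + 1) => [|y w yrho]; first by rewrite addr_ge0.
  rewrite expr0 mulr1; apply: HM; last by exists y.
  by rewrite (le_lt_trans (ler_norm M))// ltrDl.
have /choice[K HK] : forall i : 'I_m, exists K, 0 <= K /\
    forall y w, `|y| <= rho -> `|iter_derive w j (fun z => 'D_(e i) f z) y| <= K * `|w| ^+ j.
  move=> i; have [K K0 HK] := IH _ (Ck_derive (e i) Hf).
  by exists K; split.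
exists (\sum_i K i) => [|y w yrho]; first by apply: sumr_ge0 => i _; case: (HK i).
rewrite /iter_derive iterSr.
rewrite [X in iter j _ X](_ : _ = fun y => \sum_i co i w *: 'D_(e i) f y); last first.
  by apply/funext => z; apply: derive_frame => //; exact: Ck_differentiable Hf z.
rewrite -/(iter_derive w j _) iter_derive_sum => [|i]; last exact: Ck_derive.
apply: le_trans (ler_norm_sum _ _ _) _; rewrite mulr_suml; apply: ler_sum => i _.
have [K0 Ki] := HK i; have [_ cow _] := fr.
rewrite normrZ exprS mulrCA; apply: ler_pM => //; exact: Ki.
Qed.

Lemma is_derive_line (V W : normedModType R) (f : V -> W) (z w : V) (s : R) :
  (forall y, differentiable f y) ->
  is_derive s 1 (fun t => f (z + t *: w)) ('D_w f (z + s *: w)).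
Proof.
move=> df.
have E : (fun h => h^-1 *: (((fun t : R => f (z + t *: w)) \o shift s) (h *: 1) -
      f (z + s *: w))) =
    (fun h => h^-1 *: ((f \o shift (z + s *: w)) (h *: w) - f (z + s *: w))).
  apply/funext => h /=; congr (_ *: (f _ - _)).
  by rewrite [h%:A]mulr1 scalerDl addrCA.
have : derivable f (z + s *: w) w by exact/diff_derivable/df.
by split; rewrite /derivable /derive /= E.
Qed.

Lemma mxcoord_le_norm p q (A : 'M[R]_(p, q)) i j : `|A i j| <= `|A|.
Proof.
by rewrite [leRHS]/Num.norm /= mx_normrE; exact: (le_bigmax _ _ (i, j)).
Qed.

Lemma mxnorm_le p q (A : 'M[R]_(p, q)) (b : R) : 0 <= b ->
  (forall i j, `|A i j| <= b) -> `|A| <= b.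
Proof.
move=> b0 Ab; rewrite [leLHS]/Num.norm /= mx_normrE.
by apply: bigmax_le => // i _.
Qed.

Lemma trmx_norm_le p q (A : 'M[R]_(p, q)) : `|A^T| <= `|A|.
Proof. by apply: mxnorm_le => // i j; rewrite mxE mxcoord_le_norm. Qed.

Lemma trmx_sub p q (M N : 'M[R]_(p, q)) : (M - N)^T = M^T - N^T.
Proof. by apply/matrixP => i j; rewrite !mxE. Qed.

(** The mean value theorem, entry by entry.  Iterating it integrates a bound on a
high derivative down to the function, which replaces Taylor's formula below. *)
Lemma growth_bound p q (psi dpsi : R -> 'M[R]_(p, q)) (K : R) m :
  (forall s : R, is_derive s 1 psi (dpsi s)) -> psi 0 = 0 ->
  (forall s : R, 0 <= s <= 1 -> `|dpsi s| <= K * s ^+ m) ->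
  forall s : R, 0 <= s <= 1 -> `|psi s| <= K * s ^+ m.+1.
Proof.
move=> dpsiE psi0 bound s /andP[s0 s1].
have K0 : 0 <= K.
  by have := bound 1; rewrite expr1n mulr1 ler01 lexx => /(_ isT); exact: le_trans.
apply: mxnorm_le => [|i j]; first by rewrite mulr_ge0// exprn_ge0.
have dij (t : R) : is_derive t 1 (fun t => psi t i j) (dpsi t i j).
  have dt : derivable psi t 1 by have := dpsiE t; case.
  apply: DeriveDef; first by move/derivable_mxP: dt.
  by have [_ <-] := dpsiE t; rewrite derive_mx// mxE.
have [c] : exists2 c, c \in `[0, s]%R &
    psi s i j - psi 0 i j = dpsi c i j * (s - 0).
  apply: MVT_segment => //.
  apply: continuous_subspaceT => t.
  by apply/differentiable_continuous/derivable1_diffP; case: (dij t).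
rewrite in_itv /= => /andP[c0 cs]; rewrite psi0 mxE !subr0 => ->.
rewrite normrM (ger0_norm s0) exprSr mulrA ler_wpM2r//.
apply: le_trans (mxcoord_le_norm _ _ _) _.
apply: le_trans (bound c _) _; first by rewrite c0 (le_trans cs).
by rewrite ler_wpM2l// lerXn2r.
Qed.

End smooth_maps.

(** * Symmetric differences along a line *)

Section symmetric_differences.
Context {R : realType}.

Lemma derive_opp (V W : normedModType R) (f : V -> W) (w y : V) :
  differentiable f y -> 'D_(- w) f y = - 'D_w f y.
Proof. by move=> df; rewrite !deriveE// linearN. Qed.

Section one_line.
Variables (V : normedModType R) (p q : nat) (z w : V) (K : R).
Implicit Type f : V -> 'M[R]_(p, q).

Let is_derive_plus k f (s : R) : Ck k.+1 f ->
  is_derive s 1 (fun t => f (z + t *: w)) ('D_w f (z + s *: w)).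
Proof. by move=> /Ck_differentiable; exact: is_derive_line. Qed.

Let is_derive_minus k f (s : R) : Ck k.+1 f ->
  is_derive s 1 (fun t => f (z - t *: w)) (- 'D_w f (z - s *: w)).
Proof.
move=> /Ck_differentiable df; rewrite -derive_opp//.
have := is_derive_line z (- w) s df; rewrite scalerN.
by rewrite (_ : (fun t => _) = (fun t => f (z - t *: w)))//; apply/funext => t; rewrite scalerN.
Qed.

Let der_add (F G : R -> 'M[R]_(p, q)) (s : R) dF dG :
  is_derive s 1 F dF -> is_derive s 1 G dG ->
  is_derive s 1 (fun t => F t + G t) (dF + dG).
Proof. by move=> HF HG; exact: is_deriveD. Qed.

Let der_sub (F G : R -> 'M[R]_(p, q)) (s : R) dF dG :
  is_derive s 1 F dF -> is_derive s 1 G dG ->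
  is_derive s 1 (fun t => F t - G t) (dF - dG).
Proof. by move=> HF HG; exact: is_deriveB. Qed.

Let der_scale (a b : R -> R) (v : 'M[R]_(p, q)) (s : R) :
  is_derive s 1 a (b s) -> is_derive s 1 (fun t => a t *: v) (b s *: v).
Proof.
move=> [/derivable1_diffP da <-].
have dv : differentiable (fun t : R => a t *: v) s by exact: differentiableZl.
apply: DeriveDef; first exact/derivable1_diffP.
by rewrite !deriveE// diffZl.
Qed.

(** In the next four lemmas, the derivative in [s] of the symmetric difference of
[f] is the symmetric difference, of opposite parity and of one order less, of
['D_w f].  So each bound is integrated from the preceding one, and the first one
from the bound on the derivative, by [growth_bound]. *)
Lemma sym_diff1 f : Ck 1 f ->
  (forall s : R, `|s| <= 1 -> `|iter_derive w 1 f (z + s *: w)| <= K) ->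
  forall s : R, 0 <= s <= 1 ->
    `|f (z + s *: w) - f (z - s *: w)| <= (2 * K) * s ^+ 1.
Proof.
move=> Hf HK.
apply: (growth_bound (dpsi := fun s => 'D_w f (z + s *: w) + 'D_w f (z - s *: w))).
- move=> s; rewrite -[X in _ + X]opprK.
  by apply: der_sub; [exact: is_derive_plus Hf|exact: is_derive_minus Hf].
- by rewrite scale0r subr0 addr0 subrr.
- move=> s /andP[s0 s1]; rewrite expr0 mulr1 mulr_natl mulr2n.
  apply: le_trans (ler_normD _ _) _; apply: lerD; first by apply: HK; rewrite ger0_norm.
  by rewrite -scaleNr; apply: HK; rewrite normrN ger0_norm.
Qed.

Lemma sym_diff2 f : Ck 2 f ->
  (forall s : R, `|s| <= 1 -> `|iter_derive w 2 f (z + s *: w)| <= K) ->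
  forall s : R, 0 <= s <= 1 ->
    `|f (z + s *: w) + f (z - s *: w) - 2 *: f z| <= (2 * K) * s ^+ 2.
Proof.
move=> Hf HK.
apply: (growth_bound (dpsi := fun s => 'D_w f (z + s *: w) - 'D_w f (z - s *: w))).
- move=> s; rewrite -[X in is_derive _ _ _ X]subr0.
  apply: der_sub.
  by apply: der_add; [exact: is_derive_plus Hf|exact: is_derive_minus Hf].
- by rewrite scale0r subr0 addr0 scaler_nat mulr2n subrr.
- exact: (sym_diff1 (Ck_derive w Hf)).
Qed.

Lemma sym_diff3 f : Ck 3 f ->
  (forall s : R, `|s| <= 1 -> `|iter_derive w 3 f (z + s *: w)| <= K) ->
  forall s : R, 0 <= s <= 1 ->
    `|f (z + s *: w) - f (z - s *: w) - (2 * s) *: 'D_w f z|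
      <= (2 * K) * s ^+ 3.
Proof.
move=> Hf HK.
apply: (growth_bound (dpsi := fun s =>
  'D_w f (z + s *: w) + 'D_w f (z - s *: w) - 2 *: 'D_w f z)).
- move=> s; apply: der_sub.
    rewrite -[X in _ + X]opprK.
    by apply: der_sub; [exact: is_derive_plus Hf|exact: is_derive_minus Hf].
  apply: (der_scale (b := fun=> 2)).
  by apply: is_derive_eq; rewrite [LHS]mulr1.
- by rewrite scale0r subr0 addr0 subrr sub0r mulr0 scale0r oppr0.
- exact: (sym_diff2 (Ck_derive w Hf)).
Qed.

Lemma sym_diff4 f : Ck 4 f ->
  (forall s : R, `|s| <= 1 -> `|iter_derive w 4 f (z + s *: w)| <= K) ->
  forall s : R, 0 <= s <= 1 ->
    `|f (z + s *: w) + f (z - s *: w) - 2 *: f z - s ^+ 2 *: iter_derive w 2 f z|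
      <= (2 * K) * s ^+ 4.
Proof.
move=> Hf HK.
apply: (growth_bound (dpsi := fun s => 'D_w f (z + s *: w) - 'D_w f (z - s *: w)
  - (2 * s) *: iter_derive w 2 f z)).
- move=> s; apply: der_sub.
    rewrite -[X in is_derive _ _ _ X]subr0.
    apply: der_sub.
    by apply: der_add; [exact: is_derive_plus Hf|exact: is_derive_minus Hf].
  apply: (der_scale (b := fun s => 2 * s)).
  have := is_deriveX 2 (is_derive_id s (1 : R)).
  by rewrite exprfctE expr1 [_ *: 1]mulr1.
- by rewrite scale0r subr0 addr0 scaler_nat mulr2n subrr sub0r expr0n scale0r oppr0.
- exact: (sym_diff3 (Ck_derive w Hf)).
Qed.

End one_line.
End symmetric_differences.

(** * Bounds that are uniform on balls *)

Section uniform_bounds.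
Context {R : realType}.

Lemma smooth_bounds (V : normedModType R) m (e : 'I_m -> V) co p q
    (f : V -> 'M[R]_(p, q)) (rho : R) :
  finite_frame e co -> Ck 4 f ->
  exists2 K, 0 <= K & forall z w : V, `|z| + `|w| <= rho ->
  [/\ `|f (z + w) - f (z - w)| <= K * `|w|,
      `|f (z + w) + f (z - w) - 2 *: f z| <= K * `|w| ^+ 2,
      `|f (z + w) - f (z - w) - 2 *: 'D_w f z| <= K * `|w| ^+ 3
    & `|f (z + w) + f (z - w) - 2 *: f z - iter_derive w 2 f z| <= K * `|w| ^+ 4].
Proof.
move=> fr Hf.
have bd j : (j <= 4)%N -> exists2 K, 0 <= K &
    forall z w : V, `|z| + `|w| <= rho -> forall s : R, `|s| <= 1 ->
      `|iter_derive w j f (z + s *: w)| <= K * `|w| ^+ j.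
  move=> j4; have [K K0 HK] := iter_derive_bounded rho fr (Ck_le j4 Hf).
  exists K => // z w zw s s1; apply: HK; apply: le_trans (ler_normD _ _) _.
  by apply: le_trans zw; rewrite lerD2l normrZ ler_piMl.
have [K1 K10 H1] := bd 1%N isT; have [K2 K20 H2] := bd 2%N isT.
have [K3 K30 H3] := bd 3%N isT; have [K4 K40 H4] := bd 4%N isT.
exists (2 * (K1 + K2 + K3 + K4)) => [|z w zw].
  by rewrite mulr_ge0// !addr_ge0.
have one : 0 <= (1 : R) <= 1 by rewrite ler01 lexx.
have C1 : Ck 1 f by exact: Ck_le Hf.
have C2 : Ck 2 f by exact: Ck_le Hf.
have C3 : Ck 3 f by exact: Ck_le Hf.
have wn n : 0 <= `|w| ^+ n by rewrite exprn_ge0.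
split.
- have := sym_diff1 C1 (H1 z w zw) one; rewrite !scale1r expr1n mulr1 => /le_trans; apply.
  by rewrite mulrA expr1 ler_wpM2r//; lra.
- have := sym_diff2 C2 (H2 z w zw) one; rewrite !scale1r expr1n mulr1 => /le_trans; apply.
  by rewrite mulrA ler_wpM2r//; lra.
- have := sym_diff3 C3 (H3 z w zw) one; rewrite !scale1r expr1n !mulr1 => /le_trans; apply.
  by rewrite mulrA ler_wpM2r//; lra.
- have := sym_diff4 Hf (H4 z w zw) one; rewrite !scale1r !expr1n scale1r mulr1 => /le_trans; apply.
  by rewrite mulrA ler_wpM2r//; lra.
Qed.

Lemma smooth_lipschitz (V : normedModType R) m (e : 'I_m -> V) co p q
    (f : V -> 'M[R]_(p, q)) (rho : R) :
  finite_frame e co -> Ck 4 f ->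
  exists2 K, 0 <= K & forall y z : V, `|y| <= rho -> `|z| <= rho ->
    `|f y - f z| <= K * `|y - z|.
Proof.
move=> fr Hf; have [K K0 HK] := smooth_bounds (2 * rho) fr Hf.
exists K => // y z yr zr.
have half u v : `|2^-1 *: (u + v) : V| <= 2^-1 * (`|u| + `|v|).
  by rewrite normrZ ger0_norm// ler_wpM2l// ler_normD.
have [|+ _ _ _] := HK (2^-1 *: (y + z)) (2^-1 *: (y - z)).
  have := half y z; have := half y (- z); rewrite normrN; lra.
rewrite -scalerDr -scalerBr.
have -> : y + z + (y - z) = 2 *: y by rewrite scaler_nat mulr2n addrACA subrr addr0.
have -> : y + z - (y - z) = 2 *: z.
  by rewrite scaler_nat mulr2n opprB addrACA addrC addrA subrK.
rewrite !scalerA mulVf// !scale1r => /le_trans; apply.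
rewrite ler_wpM2l// normrZ ger0_norm//; have := normr_ge0 (y - z); lra.
Qed.

Lemma derive_lipschitz (V : normedModType R) m (e : 'I_m -> V) co p q
    (f : V -> 'M[R]_(p, q)) (rho : R) :
  finite_frame e co -> Ck 5 f ->
  exists2 K, 0 <= K & forall w y z : V, `|y| <= rho -> `|z| <= rho ->
    `|'D_w f y - 'D_w f z| <= K * `|w| * `|y - z|.
Proof.
move=> fr Hf.
have /choice[K HK] : forall i : 'I_m, exists K, 0 <= K /\
    forall y z : V, `|y| <= rho -> `|z| <= rho ->
      `|'D_(e i) f y - 'D_(e i) f z| <= K * `|y - z|.
  move=> i; have [K K0 HK] := smooth_lipschitz rho fr (Ck_derive (e i) Hf).
  by exists K; split.
exists (\sum_i K i) => [|w y z yr zr]; first by apply: sumr_ge0 => i _; case: (HK i).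
have df := Ck_differentiable Hf.
rewrite !(derive_frame _ fr)// -sumrB; apply: le_trans (ler_norm_sum _ _ _) _.
rewrite !mulr_suml; apply: ler_sum => i _; have [K0 Ki] := HK i.
have [_ cow _] := fr.
by rewrite -scalerBr normrZ mulrAC mulrC ler_pM// Ki.
Qed.

(** The increments of [f] over two nearby segments differ by little: compare [f]
along the parametrizations y2 + s (y1 - y2) and z2 + s (z1 - z2).  The product in
the bound is what makes the magnetic term of the scheme stable: there
[`|z1 - z2|] is O(h), so position errors are multiplied by a small factor. *)
Lemma second_difference (V : normedModType R) m (e : 'I_m -> V) co p q
    (f : V -> 'M[R]_(p, q)) (rho : R) :
  finite_frame e co -> Ck 5 f ->
  exists2 K, 0 <= K & forall y1 y2 z1 z2 : V,
    `|y1| <= rho -> `|y2| <= rho -> `|z1| <= rho -> `|z2| <= rho ->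
    `|(f y1 - f y2) - (f z1 - f z2)| <=
      K * (`|(y1 - y2) - (z1 - z2)| + (`|y1 - z1| + `|y2 - z2|) * `|z1 - z2|).
Proof.
move=> fr Hf.
have [K1 K10 HK1] := iter_derive_bounded (3 * rho) fr (Ck_le (isT : (1 <= 5)%N) Hf).
have [K2 K20 HK2] := derive_lipschitz (3 * rho) fr Hf.
exists (K1 + K2) => [|y1 y2 z1 z2 y1r y2r z1r z2r]; first exact: addr_ge0.
have df := Ck_differentiable Hf.
pose psi (s : R) := f (y2 + s *: (y1 - y2)) - f (z2 + s *: (z1 - z2)) - (f y2 - f z2).
pose dpsi (s : R) := 'D_(y1 - y2) f (y2 + s *: (y1 - y2))
  - 'D_(z1 - z2) f (z2 + s *: (z1 - z2)).
set D := _ + _ * _.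
have D0 : 0 <= D by rewrite addr_ge0// mulr_ge0// addr_ge0.
have psiE (s : R) : is_derive s 1 psi (dpsi s).
  rewrite /psi /dpsi -[X in is_derive _ _ _ X]subr0.
  have h1 := is_derive_line y2 (y1 - y2) s df.
  have h2 := is_derive_line z2 (z1 - z2) s df.
  apply: (is_deriveB (is_deriveB h1 h2)).
have in3 (s : R) u v : 0 <= s <= 1 -> `|u| <= rho -> `|v| <= rho ->
    `|v + s *: (u - v) : V| <= 3 * rho.
  move=> /andP[s0 s1] ur vr; apply: le_trans (ler_normD _ _) _.
  rewrite normrZ ger0_norm//; have := ler_normB u v; have := normr_ge0 (u - v); nra.
have bound (s : R) : 0 <= s <= 1 -> `|dpsi s| <= ((K1 + K2) * D) * s ^+ 0.
  move=> s01; rewrite expr0 mulr1 /dpsi.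
  set P := y2 + _; set Q := z2 + _.
  have Pr : `|P| <= 3 * rho by exact: in3.
  have Qr : `|Q| <= 3 * rho by exact: in3.
  have -> : 'D_(y1 - y2) f P - 'D_(z1 - z2) f Q =
      'D_((y1 - y2) - (z1 - z2)) f P + ('D_(z1 - z2) f P - 'D_(z1 - z2) f Q).
    by rewrite !deriveE// [in RHS]linearB subrKA.
  have PQ : `|P - Q| <= `|y1 - z1| + `|y2 - z2|.
    have -> : P - Q = s *: (y1 - z1) + (1 - s) *: (y2 - z2).
      rewrite scalerBl scale1r addrCA -scalerBr /P /Q opprD addrACA -scalerBr.
      congr (_ + _ *: _); rewrite !opprB -!addrA; congr (_ + _).
      by rewrite addrCA [RHS]addrCA; congr (_ + _); exact: addrC.
    apply: le_trans (ler_normD _ _) _; rewrite !normrZ.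
    have /andP[s0 s1] := s01; rewrite !ger0_norm ?subr_ge0// lerD//.
      by rewrite ler_piMl.
    by rewrite ler_piMl//; lra.
  apply: le_trans (ler_normD _ _) _.
  have := HK1 P (y1 - y2 - (z1 - z2)) Pr; rewrite /iter_derive /= expr1.
  have := HK2 (z1 - z2) P Q Pr Qr.
  have : K2 * `|z1 - z2| * `|P - Q| <= K2 * ((`|y1 - z1| + `|y2 - z2|) * `|z1 - z2|).
    by rewrite -mulrA ler_wpM2l// mulrC ler_wpM2r.
  rewrite /D; set a := `|y1 - y2 - _|; set b := (_ * `|z1 - z2|).
  have a0 : 0 <= a by exact: normr_ge0.
  have b0 : 0 <= b by rewrite mulr_ge0// addr_ge0.
  nra.
have := growth_bound psiE _ bound; rewrite /psi !scale0r !addr0 subrr => /(_ erefl 1).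
rewrite ler01 lexx !scale1r expr1n mulr1 => /(_ isT).
rewrite (addrC y2) (addrC z2) !subrK; congr (`|_| <= _).
by rewrite opprD addrACA -opprD.
Qed.

Lemma trmx_continuous m n : continuous (@trmx R m n).
Proof.
move=> A s /nbhs_ballP[e e0 es]; apply/nbhs_ballP; exists e => //= N AN.
by apply: es; case: AN => _ AN; split => // i j; rewrite !mxE; exact: AN.
Qed.

Lemma col_frame n :
  finite_frame (fun j : 'I_n => delta_mx j 0 : 'cV[R]_n) (fun j w => w j 0).
Proof.
split=> [w|j w|rho].
- apply/matrixP => i j; rewrite ord1 summxE (bigD1 i)//= big1 => [|k ki].
    by rewrite !mxE !eqxx mulr1 addr0.
  by rewrite !mxE eq_sym (negbTE ki) mulr0.
- exact: mxcoord_le_norm.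
- have -> : [set y : 'cV[R]_n | `|y| <= rho] =
      @trmx R 1 n @` [set y : 'rV[R]_n | `|y| <= rho].
    apply/seteqP; split=> [y /= yr|_ /= [y yr <-]].
      by exists y^T; rewrite ?trmxK//=; exact: le_trans (trmx_norm_le _) yr.
    exact: le_trans (trmx_norm_le _) yr.
  apply: continuous_compact; first exact/continuous_subspaceT/trmx_continuous.
  apply: bounded_closed_compact.
    by exists rho; split => [|M rM y /= yr]; [exact: num_real|exact: le_trans yr (ltW rM)].
  rewrite (_ : mkset _ = (fun y : 'rV[R]_n => `|y|) @^-1` [set t | t <= rho])//.
  apply: closed_comp => [y _|]; [exact: norm_continuous|exact: closed_le].
Qed.

Lemma real_frame :
  finite_frame (fun _ : 'I_1 => 1 : R^o) (fun _ (w : R^o) => w : R).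
Proof.
split=> [w|//|rho]; first by rewrite big_ord_recl big_ord0 addr0 [RHS]mulr1.
rewrite (_ : mkset _ = `[- rho, rho]%classic); first exact: segment_compact.
by apply/seteqP; split=> y /=; rewrite in_itv /= ler_norml.
Qed.

(** The columns of the Jacobian matrix are the partial derivatives, to which the
bounds for smooth maps apply. *)
Lemma Jac_bounds (A : 'cV[R]_3 -> 'cV[R]_3) (rho : R) : Ck 5 A ->
  exists2 K, 0 <= K &
  [/\ forall y, `|y| <= rho -> `|Jac A y| <= K,
      forall y z, `|y| <= rho -> `|z| <= rho -> `|Jac A y - Jac A z| <= K * `|y - z|
    & forall z w, `|z| + `|w| <= rho ->
        `|Jac A (z + w) + Jac A (z - w) - 2 *: Jac A z| <= K * `|w| ^+ 2].
Proof.
move=> HA.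
have fr := @col_frame 3.
have /choice[K HK] : forall j : 'I_3, exists K, [/\ 0 <= K,
    forall y, `|y| <= rho -> `|partial j A y| <= K,
    forall y z, `|y| <= rho -> `|z| <= rho ->
      `|partial j A y - partial j A z| <= K * `|y - z|
    & forall z w, `|z| + `|w| <= rho ->
      `|partial j A (z + w) + partial j A (z - w) - 2 *: partial j A z| <= K * `|w| ^+ 2].
  move=> j; have Dj : Ck 4 (partial j A) := Ck_derive (delta_mx j 0) HA.
  have [K1 K10 H1] := iter_derive_bounded rho fr (Ck_le (isT : (0 <= 4)%N) Dj).
  have [K2 K20 H2] := smooth_lipschitz rho fr Dj.
  have [K3 K30 H3] := smooth_bounds rho fr Dj.
  exists (K1 + K2 + K3); split=> [|y yr|y z yr zr|z w zw].
  - by rewrite !addr_ge0.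
  - by have := H1 y 0 yr; rewrite expr0 mulr1 /iter_derive /=; lra.
  - apply: le_trans (H2 _ _ yr zr) _; rewrite ler_wpM2r//; lra.
  - have [_ + _ _] := H3 _ _ zw => /le_trans; apply.
    by rewrite ler_wpM2r ?exprn_ge0//; lra.
have K0 j : 0 <= K j by case: (HK j).
have Ksum j : K j <= \sum_i K i.
  by rewrite (bigD1 j)//= lerDl; apply: sumr_ge0.
exists (\sum_i K i); first exact: sumr_ge0.
split=> [y yr|y z yr zr|z w zw].
- apply: mxnorm_le => [|i j]; first exact: sumr_ge0.
  rewrite mxE; have [_ Hj _ _] := HK j.
  exact: le_trans (mxcoord_le_norm _ _ _) (le_trans (Hj y yr) (Ksum j)).
- apply: mxnorm_le => [|i j]; first by rewrite mulr_ge0// sumr_ge0.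
  have [_ _ Hj _] := HK j.
  apply: le_trans (ler_wpM2r (normr_ge0 _) (Ksum j)); apply: le_trans (Hj y z yr zr).
  by have := mxcoord_le_norm (partial j A y - partial j A z) i 0; rewrite !mxE.
- apply: mxnorm_le => [|i j]; first by rewrite mulr_ge0 ?exprn_ge0// sumr_ge0.
  have [_ _ _ Hj] := HK j.
  apply: le_trans (ler_wpM2r (exprn_ge0 _ (normr_ge0 _)) (Ksum j)).
  apply: le_trans (Hj z w zw).
  have := mxcoord_le_norm (partial j A (z + w) + partial j A (z - w) - 2 *: partial j A z) i 0.
  by rewrite !mxE.
Qed.

Lemma Jac_mulmx (A : 'cV[R]_3 -> 'cV[R]_3) (y w : 'cV[R]_3) : differentiable A y ->
  Jac A y *m w = 'D_w A y.
Proof.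
move=> dA; rewrite (derive_frame _ (@col_frame 3))//.
apply/matrixP => i j; rewrite ord1 !mxE summxE; apply: eq_bigr => k _.
by rewrite !mxE mulrC.
Qed.

End uniform_bounds.

(** * Filters and the magnetic field *)

Section filters.
Context {R : realType}.

Lemma trig_taylor (z : R) : 0 <= z ->
  [/\ 0 <= 1 - cos z, 1 - cos z <= z ^+ 2, 0 <= z - sin z & z - sin z <= z ^+ 3].
Proof.
have sin_le (t : R) : 0 <= t -> `|sin t| <= t :> R.
  move=> t0; have [c _] : exists2 c, c \in `[0, t]%R &
      sin t - sin 0 = cos c * (t - 0).
    apply: MVT_segment => //; exact/continuous_subspaceT/continuous_sin.
  rewrite sin0 !subr0 => ->; rewrite normrM (ger0_norm t0) ler_piMl//.
  by rewrite ler_norml cos_geN1 cos_le1.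
have cos_ge (t : R) : 0 <= t -> 0 <= 1 - cos t <= t ^+ 2.
  move=> t0; rewrite subr_ge0 cos_le1 /=.
  have [c] : exists2 c, c \in `[0, t]%R & cos t - cos 0 = - sin c * (t - 0).
    apply: MVT_segment => //; exact/continuous_subspaceT/continuous_cos.
  rewrite in_itv /= cos0 subr0 => /andP[c0 ct] E.
  rewrite -opprB E mulNr opprK expr2 ler_wpM2r//.
  exact: le_trans (ler_norm _) (le_trans (sin_le _ c0) ct).
move=> z0; have /andP[-> ->] := cos_ge _ z0.
have [c] : exists2 c, c \in `[0, z]%R &
    (z - sin z) - (0 - sin 0) = (1 - cos c) * (z - 0).
  apply: (@MVT_segment _ (fun t => t - sin t) (fun t => 1 - cos t)) => //.
  apply: continuous_subspaceT => t; apply: continuousB; first exact: cvg_id.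
  exact: continuous_sin.
rewrite in_itv /= sin0 !subr0 => /andP[c0 cz] ->.
have /andP[h1 h2] := cos_ge _ c0.
split=> //; first exact: mulr_ge0.
rewrite exprSr ler_wpM2r//; apply: le_trans h2 _.
by rewrite lerXn2r.
Qed.

(** Both quotients are 1 + O(h^2), because sin z - z = O(z^3) and
cos z - 1 = O(z^2), while the denominators stay above 3/4 of their leading term
for z = h / 2 <= 1/2. *)
Lemma tanc_sinc_bounds (h : R) : 0 < h <= 1 ->
  `|1 - tanc (h / 2)| <= h ^+ 2 /\ `|1 - (sinc (h / 2))^-1| <= h ^+ 2.
Proof.
move=> /andP[h0 h1]; have z0 : 0 < h / 2 by rewrite divr_gt0.
have [] := trig_taylor (ltW z0).
rewrite /tanc /sinc /tan; set c := cos _; set s := sin _.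
have hz : h = 2 * (h / 2) by rewrite mulrC divfK.
rewrite [in X in _ <= X /\ _]hz [in X in _ /\ _ <= X]hz.
set z := h / 2 in z0 hz *; move=> c1 c2 s1 s2.
have zz : z <= 2^-1 by rewrite /z; lra.
have z2 : z ^+ 2 <= 4^-1 by nra.
have c0 : 3 / 4 <= c by lra.
have s0 : 3 / 4 * z <= s.
  have : z ^+ 3 <= z * 4^-1 by rewrite exprS ler_wpM2l// ltW.
  lra.
have cp : 0 < c by lra.
have sp : 0 < s by apply: lt_le_trans s0; rewrite mulr_gt0//.
split.
  have -> : 1 - s / c / z = (z * c - s) / (z * c).
    by field; rewrite ?gt_eqF//.
  have zc : 0 < z * c by rewrite mulr_gt0.
  rewrite normrM normfV (gtr0_norm zc) ler_pdivrMr//.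
  have zc1 : 3 / 4 * z <= z * c by rewrite mulrC ler_wpM2l// ltW.
  have : z ^+ 3 <= (2 * z) ^+ 2 * (z * c).
    have : 0 <= z ^+ 2 by rewrite exprn_ge0// ltW.
    rewrite exprMn exprSr; nra.
  move=> /(le_trans _); apply; rewrite ler_norml.
  have : z * (1 - c) <= z ^+ 3 by rewrite exprS ler_wpM2l// ltW.
  have : 0 <= z * (1 - c) by rewrite mulr_ge0// ltW.
  by move=> ? ?; apply/andP; split; lra.
rewrite invf_div.
have -> : 1 - z / s = (s - z) / s by field; rewrite ?gt_eqF.
rewrite normrM normfV (gtr0_norm sp) ler_pdivrMr//.
have : z ^+ 3 <= (2 * z) ^+ 2 * s.
  have : 0 <= z ^+ 2 by rewrite exprn_ge0// ltW.
  rewrite exprMn exprSr; nra.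
move=> /(le_trans _); apply; rewrite ler_norml.
have : 0 <= z ^+ 3 by rewrite exprn_ge0// ltW.
by move=> ?; apply/andP; split; lra.
Qed.

Lemma norm_mulmx m n (M : 'M[R]_(m, n)) (v : 'cV[R]_n) :
  `|M *m v| <= n%:R * `|M| * `|v|.
Proof.
apply: mxnorm_le => [|i j]; first by rewrite !mulr_ge0.
rewrite mxE; apply: le_trans (ler_norm_sum _ _ _) _.
rewrite -mulrA mulr_natl -[X in _ *+ X]card_ord -sumr_const; apply: ler_sum => k _.
by rewrite normrM ler_pM// mxcoord_le_norm.
Qed.

Lemma mulmx_prod_split n m (M Q : 'M[R]_(m, n)) (u z : 'cV[R]_n) :
  M *m u - Q *m z = (M - Q) *m u + Q *m (u - z).
Proof. by rewrite mulmxBl mulmxBr addrA subrK. Qed.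

Lemma filter_near_id (B0 : 'cV[R]_3) : exists2 K, 0 <= K &
  forall (h : R) (v : 'cV[R]_3), 0 < h <= 1 ->
    `|Psi B0 h *m v - v| <= K * h ^+ 2 * `|v| /\
    `|Phi B0 h *m v - v| <= K * h ^+ 2 * `|v|.
Proof.
set M := Btilde B0 *m Btilde B0.
exists (3 * `|M|) => [|h v h01]; first by rewrite mulr_ge0.
have [tb sb] := tanc_sinc_bounds h01.
have H (a : R) : `|a| <= h ^+ 2 ->
    `|(1%:M + a *: M) *m v - v| <= 3 * `|M| * h ^+ 2 * `|v|.
  move=> ah; rewrite mulmxDl mul1mx addrC addKr -scalemxAl normrZ.
  rewrite mulrAC [leRHS]mulrC; apply: ler_pM => //.
  exact: norm_mulmx.
by split; exact: H.
Qed.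

End filters.

Section magnetic_field.
Context {R : realType}.
Implicit Types (A : 'cV[R]_3 -> 'cV[R]_3) (v y : 'cV[R]_3).

Let ordE (i : 'I_3) :
  (i + 1 + 1 = i + 2) * (i + 1 + 2 = i) * (i + 2 + 1 = i) * (i + 2 + 2 = i + 1).
Proof.
by split; first split; first split; apply/val_inj; case: i => [[|[|[|//]]] Hi].
Qed.

Let ord_neqE (i : 'I_3) :
  ((i + 1 == i) = false) * ((i + 2 == i) = false) *
  ((i == i + 1) = false) * ((i == i + 2) = false) *
  ((i + 2 == i + 1) = false) * ((i + 1 == i + 2) = false).
Proof. by case: i => [[|[|[|//]]] Hi]. Qed.

Let sum_ord3 (i : 'I_3) (G : 'I_3 -> R) :
  \sum_k G k = G i + G (i + 1) + G (i + 2).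
Proof.
rewrite (bigD1 i)//= (bigD1 (i + 1)) /=; last by rewrite ord_neqE.
rewrite (bigD1 (i + 2)) /=; last by rewrite !ord_neqE.
rewrite big1 => [|k]; first by rewrite addr0 addrA.
by case: i k => [[|[|[|//]]] Hi] [[|[|[|//]]] Hk].
Qed.

(** This is how the variational scheme sees the magnetic force: the skew part of
the Jacobian of the vector potential acts as a cross product. *)
Lemma lorentz_curl A y v :
  (Jac A y)^T *m v - Jac A y *m v = cross v (curl A y).
Proof.
apply/matrixP => i j; rewrite ord1 !mxE !(sum_ord3 i) !mxE !ordE.
have alg (w : 'I_3 -> R) (P : 'I_3 -> 'I_3 -> R) (a b c : 'I_3) :
    P a a * w a + P a b * w b + P a c * w c -
    (P a a * w a + P b a * w b + P c a * w c) =
    w b * (P a b - P b a) - w c * (P c a - P a c) by ring.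
exact: (alg (fun k => v k 0) (fun j k => partial j A y k 0)).
Qed.

(** The linear part - x x B0 / 2 of the potential contributes the constant field
[B0]; being linear, it is its own directional derivative. *)
Lemma curl_potential (B0 : 'cV[R]_3) A1 y :
  differentiable (potential B0 A1) y ->
  curl (potential B0 A1) y = B0 + curl A1 y.
Proof.
move=> dA; pose L (z : 'cV[R]_3) := 2^-1 *: cross z B0.
have dL v : is_derive y v L (L v).
  have E : (fun h : R => h^-1 *: ((L \o shift y) (h *: v) - L y)) @ 0^' --> L v.
    apply: cvg_near_cst; near=> h.
    have h0 : h != 0 by near: h; exact: nbhs_dnbhs_neq.
    rewrite /= /L; apply/matrixP => i j; rewrite !mxE; field.
    by [].
  by split; [apply/cvg_ex; exists (L v)|exact/cvg_lim].
set A := potential B0 A1 in dA *.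
have A1E : A1 = A + L.
  by apply/funext => z; rewrite /A /potential /L fctE addrAC addNr add0r.
have pE j : partial j A1 y = partial j A y + L (delta_mx j 0).
  have dAj : derivable A y (delta_mx j 0) by exact: diff_derivable.
  have [dLj DL] := dL (delta_mx j 0).
  by rewrite A1E /partial deriveD// DL.
clearbody A; have LE j i : L (delta_mx j 0) i 0 =
    2^-1 * ((i + 1 == j)%:R * B0 (i + 2) 0 - (i + 2 == j)%:R * B0 (i + 1) 0).
  by rewrite !mxE !andbT.
clearbody L; apply/matrixP => i j; rewrite ord1 !mxE !pE.
rewrite ![(_ + L _) _ _]mxE !LE !ordE !eqxx !ord_neqE /=.
have alg (a b c d e : R) : a - b =
    c + (a + 2^-1 * (0 * d - 1 * c) - (b + 2^-1 * (1 * c - 0 * e))) by field.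
exact: (alg (partial (i + 1) A y (i + 2) 0)).
Unshelve. all: by end_near. Qed.

End magnetic_field.

(** * Orders in the step size, uniform in time *)

Section uniform_order.
Context {R : realType}.
Variable T : R.

(** Landau's O(h^n), uniform in the time; the range of [h] is fixed so that
estimates can be combined without shrinking it. *)
Definition uO {W : normedModType R} (n : nat) (f : R -> R -> W) : Prop :=
  exists2 K, 0 <= K &
    forall h t : R, 0 < h <= 1 -> 0 <= t <= T -> `|f h t| <= K * h ^+ n.

Implicit Type W : normedModType R.

Lemma uO_eq W n (f g : R -> R -> W) :
  (forall h t, 0 < h <= 1 -> 0 <= t <= T -> g h t = f h t) -> uO n f -> uO n g.
Proof.
by move=> fg [K K0 HK]; exists K => // h t hh tt; rewrite fg//; exact: HK.
Qed.

Lemma uO_le W m n (f : R -> R -> W) : (m <= n)%N -> uO n f -> uO m f.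
Proof.
move=> mn [K K0 HK]; exists K => // h t hh tt; apply: le_trans (HK h t hh tt) _.
by have /andP[h0 h1] := hh; rewrite ler_wpM2l// ler_wiXn2l// ltW.
Qed.

Lemma uO_add W n (f g : R -> R -> W) :
  uO n f -> uO n g -> uO n (fun h t => f h t + g h t).
Proof.
move=> [K K0 HK] [L L0 HL]; exists (K + L) => [|h t hh tt]; first exact: addr_ge0.
apply: le_trans (ler_normD _ _) _; rewrite mulrDl lerD//; [exact: HK|exact: HL].
Qed.

Lemma uO_scale W n (a : R) (f : R -> R -> W) :
  uO n f -> uO n (fun h t => a *: f h t).
Proof.
move=> [K K0 HK]; exists (`|a| * K) => [|h t hh tt]; first exact: mulr_ge0.
by rewrite normrZ -mulrA ler_wpM2l// HK.
Qed.

Lemma uO_opp W n (f : R -> R -> W) : uO n f -> uO n (fun h t => - f h t).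
Proof. by move=> [K K0 HK]; exists K => // h t hh tt; rewrite normrN HK. Qed.

Lemma uO_sub W n (f g : R -> R -> W) :
  uO n f -> uO n g -> uO n (fun h t => f h t - g h t).
Proof. by move=> Hf Hg; apply: uO_add => //; exact: uO_opp. Qed.

Lemma uO_mulX W k n (f : R -> R -> W) :
  uO n f -> uO (k + n) (fun h t => h ^+ k *: f h t).
Proof.
move=> [K K0 HK]; exists K => // h t hh tt; have /andP[h0 _] := hh.
rewrite normrZ ger0_norm ?exprn_ge0 ?(ltW h0)// exprD mulrCA.
by rewrite ler_wpM2l ?HK// exprn_ge0// ltW.
Qed.

Lemma uO_div W n (f : R -> R -> W) :
  uO n.+1 f -> uO n (fun h t => h^-1 *: f h t).
Proof.
move=> [K K0 HK]; exists K => // h t hh tt; have /andP[h0 _] := hh.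
rewrite normrZ ger0_norm ?invr_ge0 ?(ltW h0)// ler_pdivrMl//.
by rewrite mulrCA -exprS HK.
Qed.

Lemma uO_mulmx m n p q r (f : R -> R -> 'M[R]_(p, q)) (g : R -> R -> 'cV[R]_q) :
  uO m f -> uO n g -> r = (m + n)%N -> uO r (fun h t => f h t *m g h t).
Proof.
move=> [K K0 HK] [L L0 HL] ->; exists (q%:R * K * L) => [|h t hh tt].
  by rewrite !mulr_ge0.
apply: le_trans (norm_mulmx _ _) _.
have -> : q%:R * K * L * h ^+ (m + n) = q%:R * ((K * h ^+ m) * (L * h ^+ n)).
  by rewrite exprD; ring.
rewrite -mulrA ler_wpM2l//.
by apply: ler_pM => //; [exact: HK|exact: HL].
Qed.

Lemma uO_trmx n p q (f : R -> R -> 'M[R]_(p, q)) :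
  uO n f -> uO n (fun h t => (f h t)^T).
Proof.
move=> [K K0 HK]; exists K => // h t hh tt; have /andP[h0 _] := hh.
apply: mxnorm_le => [|i j]; first by rewrite mulr_ge0// exprn_ge0// ltW.
by rewrite mxE; apply: le_trans (mxcoord_le_norm _ _ _) _; exact: HK.
Qed.

Section local_maps.
Variables (p q : nat) (M : R) (y z : R -> R -> 'cV[R]_3).
Hypothesis yM : forall h t, 0 < h <= 1 -> 0 <= t <= T -> `|y h t| <= M.
Hypothesis zM : forall h t, 0 < h <= 1 -> 0 <= t <= T -> `|z h t| <= M.

Let mid h t : 'cV[R]_3 := midpoint (y h t) (z h t).
Let half h t : 'cV[R]_3 := 2^-1 *: (y h t - z h t).

Let mid_add_half h t : mid h t + half h t = y h t.
Proof. by apply/matrixP => i j; rewrite !mxE; field. Qed.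

Let mid_sub_half h t : mid h t - half h t = z h t.
Proof. by apply/matrixP => i j; rewrite !mxE; field. Qed.

Let mid_half_le h t : 0 < h <= 1 -> 0 <= t <= T ->
  `|mid h t| + `|half h t| <= 2 * M.
Proof.
move=> hh tt; rewrite /mid /half /midpoint !normrZ ger0_norm//.
have := ler_normD (y h t) (z h t); have := ler_normB (y h t) (z h t).
by have := yM hh tt; have := zM hh tt; lra.
Qed.

Lemma uO_lipschitz n K (G : 'cV[R]_3 -> 'M[R]_(p, q)) : 0 <= K ->
  (forall u v, `|u| <= M -> `|v| <= M -> `|G u - G v| <= K * `|u - v|) ->
  uO n (fun h t => y h t - z h t) -> uO n (fun h t => G (y h t) - G (z h t)).
Proof.
move=> K0 HK [L L0 HL]; exists (K * L) => [|h t hh tt]; first exact: mulr_ge0.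
apply: le_trans (HK _ _ (yM hh tt) (zM hh tt)) _.
by rewrite -mulrA ler_wpM2l// HL.
Qed.

(** Both this lemma and the next one expand about the midpoint of [y] and [z], for
which the odd, respectively even, terms cancel. *)
Lemma uO_sym_mean K (G : 'cV[R]_3 -> 'M[R]_(p, q)) : 0 <= K ->
  (forall u v, `|u| + `|v| <= 2 * M ->
    `|G (u + v) + G (u - v) - 2 *: G u| <= K * `|v| ^+ 2) ->
  uO 1 (fun h t => y h t - z h t) ->
  uO 2 (fun h t => G (y h t) + G (z h t) - 2 *: G (midpoint (y h t) (z h t))).
Proof.
move=> K0 HK /(uO_scale 2^-1)[L L0 HL].
exists (K * L ^+ 2) => [|h t hh tt]; first by rewrite mulr_ge0// exprn_ge0.
have := HK _ _ (mid_half_le hh tt); rewrite mid_add_half mid_sub_half.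
move/le_trans; apply; rewrite -mulrA ler_wpM2l// -exprMn lerXn2r ?nnegrE//.
  by rewrite mulr_ge0//; case/andP: hh => /ltW.
by have := HL h t hh tt; rewrite expr1.
Qed.

Lemma uO_midpoint_rule (G : 'cV[R]_3 -> 'cV[R]_3) : Ck 5 G ->
  uO 1 (fun h t => y h t - z h t) ->
  uO 3 (fun h t => G (y h t) - G (z h t) -
    Jac G (midpoint (y h t) (z h t)) *m (y h t - z h t)).
Proof.
move=> HG /(uO_scale 2^-1)[L L0 HL].
have [K K0 HK] := smooth_bounds (2 * M) (@col_frame _ 3) (Ck_le (isT : (4 <= 5)%N) HG).
exists (K * L ^+ 3) => [|h t hh tt]; first by rewrite mulr_ge0// exprn_ge0.
have [_ _ + _] := HK _ _ (mid_half_le hh tt); rewrite mid_add_half mid_sub_half.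
rewrite -Jac_mulmx; last exact: Ck_differentiable HG _.
rewrite -scalemxAr !scalerA mulfV// scale1r => /le_trans; apply.
rewrite -mulrA ler_wpM2l// -exprMn lerXn2r ?nnegrE//.
  by rewrite mulr_ge0//; case/andP: hh => /ltW.
by have := HL h t hh tt; rewrite expr1.
Qed.

End local_maps.
End uniform_order.

(** * Consistency: defects of the exact solution *)

Section consistency.
Context {R : realType}.
Variables (T : R) (B0 : 'cV[R]_3) (A F : 'cV[R]_3 -> 'cV[R]_3) (x : R -> 'cV[R]_3).

Definition FVI_rhs (h : R) (xm y xp : 'cV[R]_3) : 'cV[R]_3 :=
  let yp := midpoint y xp in
  let ym := midpoint y xm in
  (h / 2) *: ((Jac A yp)^T *m (xp - y)) + (h / 2) *: ((Jac A ym)^T *m (y - xm))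
  - h *: (A yp - A ym) + (h ^+ 2 / 2) *: (F yp + F ym).

Definition FVI_start_rhs (h : R) (x0 v0 x1 : 'cV[R]_3) : 'cV[R]_3 :=
  let xh := midpoint x0 x1 in
  (v0 + A x0) + 2^-1 *: ((Jac A xh)^T *m (x1 - x0)) - A xh + (h / 2) *: F xh.

(* Splitting into mean and difference: each product on the right pairs an even
   with an odd function of [h], and both factors then have their full order. *)
Let mulmx_mean_split (M N Q : 'M[R]_3) (u w z : 'cV[R]_3) :
  M *m u + N *m w - 2 *: (Q *m z) =
  2^-1 *: ((M + N - 2 *: Q) *m (u + w)) + Q *m (u + w - 2 *: z)
  + 2^-1 *: ((M - N) *m (u - w)).
Proof.
rewrite !(mulmxBl, mulmxBr, mulmxDl, mulmxDr) -!scalemxAl -!scalemxAr.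
move: (M *m u) (M *m w) (N *m u) (N *m w) (Q *m u) (Q *m w) (Q *m z) => *.
by apply/matrixP => i j; rewrite !mxE; field.
Qed.

Let mulmx_diff_split (u1 u2 w z : 'cV[R]_3) (M Q : 'M[R]_3) :
  u1 - u2 - Q *m z = u1 - u2 - M *m w + (M - Q) *m w + Q *m (w - z).
Proof.
rewrite mulmxBl mulmxBr; move: (M *m w) (Q *m w) (Q *m z) => *.
by apply/matrixP => i j; rewrite !mxE; ring.
Qed.

Let FVI_rhs_split (h : R) (p q a1 a2 f1 f2 f0 j1 j2 : 'cV[R]_3) :
  (h / 2) *: p + (h / 2) *: q - h *: (a1 - a2) + (h ^+ 2 / 2) *: (f1 + f2)
    - h ^+ 2 *: (j1 - j2 + f0) =
  2^-1 *: (h ^+ 1 *: (p + q - 2 *: (h *: j1))) - h ^+ 1 *: (a1 - a2 - h *: j2)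
  + 2^-1 *: (h ^+ 2 *: (f1 + f2 - 2 *: f0)).
Proof. by apply/matrixP => i j; rewrite !mxE; field. Qed.

Let trmx_mean (M N Q : 'M[R]_3) : M^T + N^T - 2 *: Q^T = (M + N - 2 *: Q)^T.
Proof. by apply/matrixP => i j; rewrite !mxE. Qed.

Hypothesis HA : Ck 5 A.
Hypothesis HF : Ck 5 F.
Hypothesis Hx : Ck 5 (x : R^o -> 'cV[R]_3).
Hypothesis ode : forall t, 0 <= t <= T ->
  derive1n 2 x t = (Jac A (x t))^T *m derive1 x t - Jac A (x t) *m derive1 x t + F (x t).

(* These are functions of the pair (h, t), as [uO] requires, also when they do
   not depend on [h]. *)
Let P (h t : R) := x t.
Let X (h t : R) := x (t + h).
Let Y (h t : R) := x (t - h).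
Let v (h t : R) := derive1 x t.
Let a (h t : R) := derive1n 2 x t.
Let mp h t := midpoint (P h t) (X h t).
Let mm h t := midpoint (P h t) (Y h t).

Lemma trajectory_bounded : exists2 M, 0 <= M &
  forall s : R, `|s| <= T + 1 ->
    [/\ `|x s| <= M, `|derive1 x s| <= M & `|derive1n 2 x s| <= M].
Proof.
have [K0 K00 H0] := iter_derive_bounded (T + 1) (@real_frame R) (Ck_le (isT : (0 <= 5)%N) Hx).
have [K1 K10 H1] := iter_derive_bounded (T + 1) (@real_frame R) (Ck_le (isT : (1 <= 5)%N) Hx).
have [K2 K20 H2] := iter_derive_bounded (T + 1) (@real_frame R) (Ck_le (isT : (2 <= 5)%N) Hx).
exists (K0 + K1 + K2) => [|s sT]; first by rewrite !addr_ge0.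
have := H0 s 1 sT; have := H1 s 1 sT; have := H2 s 1 sT.
rewrite /iter_derive /= normr1 !expr1n !mulr1 -derive1E.
rewrite (_ : (fun y => 'D_1 x y) = derive1 x); last by apply/funext => y; rewrite derive1E.
rewrite -derive1E => h2 h1 h0; split.
- by apply: le_trans h0 _; rewrite -addrA lerDl addr_ge0.
- by apply: le_trans h1 _; rewrite addrAC lerDr addr_ge0.
- by apply: le_trans h2 _; rewrite lerDr addr_ge0.
Qed.

Let in_range (h t : R) : 0 < h <= 1 -> 0 <= t <= T ->
  [/\ `|t| <= T + 1, `|t + h| <= T + 1 & `|t - h| <= T + 1].
Proof.
by move=> /andP[h0 h1] /andP[t0 t1]; split; rewrite ler_norml; apply/andP; split; lra.
Qed.

Let derive_real (f : R -> 'cV[R]_3) (h t : R) : differentiable (f : R^o -> _) (t : R^o) ->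
  'D_h (f : R^o -> _) (t : R^o) = h *: derive1 f t.
Proof.
move=> df; rewrite derive1E !deriveE//.
by rewrite -[in LHS](mulr1 h) -[h * 1]/(h *: (1 : R^o)) linearZ.
Qed.

Let dv : Ck 4 (derive1 x : R^o -> 'cV[R]_3).
Proof.
rewrite (_ : derive1 x = fun y => 'D_1 x y); last by apply/funext => y; rewrite derive1E.
exact: Ck_derive Hx.
Qed.

Lemma trajectory_expansion :
  [/\ uO T 1 (fun h t => X h t - Y h t),
      uO T 2 (fun h t => X h t + Y h t - 2 *: P h t),
      uO T 3 (fun h t => X h t - Y h t - (2 * h) *: v h t)
    & uO T 4 (fun h t => X h t + Y h t - 2 *: P h t - h ^+ 2 *: a h t)].
Proof.
have [K K0 HK] := smooth_bounds (T + 1) (@real_frame R) (Ck_le (isT : (4 <= 5)%N) Hx).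
have dx := Ck_differentiable Hx.
have tth (h t : R) : 0 < h <= 1 -> 0 <= t <= T -> `|t : R^o| + `|h : R^o| <= T + 1.
  by move=> /andP[h0 h1] /andP[t0 t1]; rewrite !ger0_norm ?lerD// ltW.
split; exists K => // h t hh tt; have [] := HK _ _ (tth h t hh tt);
  have /andP[/ltW h0 _] := hh; rewrite (ger0_norm h0) /iter_derive /= => H1 H2 H3 H4.
- by rewrite expr1.
- exact: H2.
- by move: H3; rewrite derive_real// scalerA.
- move: H4; rewrite (_ : 'D_h _ _ = h ^+ 2 *: a h t)//.
  rewrite (_ : (fun y => _) = h \*: (derive1 x)); last first.
    by apply/funext => y; rewrite derive_real.
  rewrite deriveZ; last exact/diff_derivable/(Ck_differentiable dv).
  by rewrite derive_real ?scalerA -?expr2//; exact: (Ck_differentiable dv).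
Qed.

Lemma velocity_expansion :
  uO T 2 (fun h t => v h (t + h) + v h (t - h) - 2 *: v h t) /\
  uO T 3 (fun h t => v h (t + h) - v h (t - h) - (2 * h) *: a h t).
Proof.
have [K K0 HK] := smooth_bounds (T + 1) (@real_frame R) dv.
have tth (h t : R) : 0 < h <= 1 -> 0 <= t <= T -> `|t : R^o| + `|h : R^o| <= T + 1.
  by move=> /andP[h0 h1] /andP[t0 t1]; rewrite !ger0_norm ?lerD// ltW.
split; exists K => // h t hh tt; have [] := HK _ _ (tth h t hh tt);
  have /andP[/ltW h0 _] := hh; rewrite (ger0_norm h0) => _ H2 H3 _.
- exact: H2.
- by move: H3; rewrite derive_real ?scalerA//; exact: (Ck_differentiable dv).
Qed.

Lemma forward_expansion :
  [/\ uO T 1 (fun h t => X h t - P h t),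
      uO T 2 (fun h t => X h t - P h t - h *: v h t)
    & uO T 3 (fun h t => X h t - P h t - h *: v h t - (h ^+ 2 / 2) *: a h t)].
Proof.
have [s1 s2 s3 s4] := trajectory_expansion; split.
- apply: uO_eq (uO_scale 2^-1 (uO_add s1 (uO_le (isT : (1 <= 2)%N) s2))) => h t _ _.
  by apply/matrixP => i j; rewrite !mxE; field.
- apply: uO_eq (uO_scale 2^-1 (uO_add (uO_le (isT : (2 <= 3)%N) s3) s2)) => h t _ _.
  by apply/matrixP => i j; rewrite !mxE; field.
- apply: uO_eq (uO_scale 2^-1 (uO_add s3 (uO_le (isT : (3 <= 4)%N) s4))) => h t _ _.
  move: (X h t) (Y h t) (P h t) (v h t) (a h t) => *.
  by apply/matrixP => i j; rewrite !mxE; field.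
Qed.


Let Z h t := midpoint (mp h t) (mm h t).

Let points_bounded : exists2 M, 0 <= M & forall h t, 0 < h <= 1 -> 0 <= t <= T ->
  [/\ `|P h t| <= M, `|mp h t| <= M, `|mm h t| <= M & `|Z h t| <= M].
Proof.
have [M M0 HM] := trajectory_bounded; exists M => // h t hh tt.
have [r1 r2 r3] := in_range hh tt.
have [p1 _ _] := HM _ r1; have [p2 _ _] := HM _ r2; have [p3 _ _] := HM _ r3.
have mid u w : `|u| <= M -> `|w| <= M -> `|midpoint u w : 'cV[R]_3| <= M.
  move=> uM wM; rewrite /midpoint normrZ ger0_norm//.
  by have := ler_normD u w; lra.
have pm : `|mp h t| <= M by exact: mid.
have pp : `|mm h t| <= M by exact: mid.
by split=> //; exact: mid.
Qed.

Lemma v_order0 : uO T 0 v.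
Proof.
have [M M0 HM] := trajectory_bounded; exists M => // h t hh tt.
by have [r1 _ _] := in_range hh tt; have [_ + _] := HM _ r1; rewrite expr0 mulr1.
Qed.

Lemma a_order0 : uO T 0 a.
Proof.
have [M M0 HM] := trajectory_bounded; exists M => // h t hh tt.
by have [r1 _ _] := in_range hh tt; have [_ _] := HM _ r1; rewrite expr0 mulr1.
Qed.

Lemma field_calculus : exists M,
  [/\ forall h t, 0 < h <= 1 -> 0 <= t <= T ->
        [/\ `|P h t| <= M, `|mp h t| <= M, `|mm h t| <= M & `|Z h t| <= M],
      uO T 0 (fun h t => Jac A (P h t))
    & forall y z : R -> R -> 'cV[R]_3,
        (forall h t, 0 < h <= 1 -> 0 <= t <= T -> `|y h t| <= M) ->
        (forall h t, 0 < h <= 1 -> 0 <= t <= T -> `|z h t| <= M) ->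
      [/\ forall n, uO T n (fun h t => y h t - z h t) ->
            uO T n (fun h t => Jac A (y h t) - Jac A (z h t)),
          forall n, uO T n (fun h t => y h t - z h t) ->
            uO T n (fun h t => F (y h t) - F (z h t)),
          uO T 1 (fun h t => y h t - z h t) ->
            uO T 2 (fun h t => Jac A (y h t) + Jac A (z h t)
              - 2 *: Jac A (midpoint (y h t) (z h t))),
          uO T 1 (fun h t => y h t - z h t) ->
            uO T 2 (fun h t => F (y h t) + F (z h t)
              - 2 *: F (midpoint (y h t) (z h t)))
        & uO T 1 (fun h t => y h t - z h t) ->
            uO T 3 (fun h t => A (y h t) - A (z h t) -
              Jac A (midpoint (y h t) (z h t)) *m (y h t - z h t))]].
Proof.
have [M M0 HM] := points_bounded.
have M2 w : w <= M -> w <= 2 * M by move=> wM; lra.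
have [KJ KJ0 [J1 J2 J3]] := Jac_bounds (2 * M) HA.
have HF4 := Ck_le (isT : (4 <= 5)%N) HF.
have [KL KL0 HL] := smooth_lipschitz (2 * M) (@col_frame R 3) HF4.
have [KS KS0 HS] := smooth_bounds (2 * M) (@col_frame R 3) HF4.
exists M; split=> //.
- by exists KJ => // h t hh tt; rewrite expr0 mulr1; apply/J1/M2; case: (HM h t hh tt).
move=> y z yM zM; split=> [n yz|n yz|yz|yz|yz].
- by apply: (uO_lipschitz yM zM KJ0) yz => u w /M2 uM /M2 wM; exact: J2.
- by apply: (uO_lipschitz yM zM KL0) yz => u w /M2 uM /M2 wM; exact: HL.
- by apply: (uO_sym_mean yM zM KJ0) yz; exact: J3.
- by apply: (uO_sym_mean yM zM KS0) yz => u w uw; case: (HS _ _ uw).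
- exact: (uO_midpoint_rule yM zM HA) yz.
Qed.

(** The midpoints x_(n+1/2), x_(n-1/2) are symmetric about a point [Z] that is at
distance O(h^2) from x(t); expanding about [Z] instead of x(t) keeps the symmetric
cancellations exact, and the replacement of [Z] by x(t) afterwards costs a factor
O(h^2) in every term. *)
Lemma FVI_rhs_expansion :
  uO T 4 (fun h t => FVI_rhs h (Y h t) (P h t) (X h t) - h ^+ 2 *: a h t).
Proof.
have [s1 s2 s3 s4] := trajectory_expansion.
have [M [HM J0 calc]] := field_calculus.
have PM (h t : R) (hh : 0 < h <= 1) (tt : 0 <= t <= T) : `|P h t| <= M by case: (HM h t hh tt).
have mpM (h t : R) (hh : 0 < h <= 1) (tt : 0 <= t <= T) : `|mp h t| <= M by case: (HM h t hh tt).
have mmM (h t : R) (hh : 0 < h <= 1) (tt : 0 <= t <= T) : `|mm h t| <= M by case: (HM h t hh tt).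
have ZM (h t : R) (hh : 0 < h <= 1) (tt : 0 <= t <= T) : `|Z h t| <= M by case: (HM h t hh tt).
have mpm : uO T 1 (fun h t => mp h t - mm h t).
  apply: uO_eq (uO_scale 2^-1 s1) => h t _ _.
  by apply/matrixP => i j; rewrite !mxE; field.
have ZP : uO T 2 (fun h t => Z h t - P h t).
  apply: uO_eq (uO_scale 4^-1 s2) => h t _ _.
  by apply/matrixP => i j; rewrite !mxE; field.
have [Jl _ Jm Fm Amid] := calc _ _ mpM mmM.
have [JZ FZ _ _ _] := calc _ _ ZM PM.
have Jmean : uO T 2 (fun h t => Jac A (mp h t) + Jac A (mm h t) - 2 *: Jac A (P h t)).
  apply: uO_eq (uO_add (Jm mpm) (uO_scale 2 (JZ _ ZP))) => h t _ _.
  by rewrite scalerBr addrA subrK.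
have Fmean : uO T 2 (fun h t => F (mp h t) + F (mm h t) - 2 *: F (P h t)).
  apply: uO_eq (uO_add (Fm mpm) (uO_scale 2 (FZ _ ZP))) => h t _ _.
  by rewrite scalerBr addrA subrK.
have E1 : uO T 3 (fun h t => (Jac A (mp h t))^T *m (X h t - P h t)
    + (Jac A (mm h t))^T *m (P h t - Y h t) - 2 *: (h *: ((Jac A (P h t))^T *m v h t))).
  have JmeanT : uO T 2 (fun h t =>
      (Jac A (mp h t))^T + (Jac A (mm h t))^T - 2 *: (Jac A (P h t))^T).
    by apply: uO_eq (uO_trmx Jmean) => h t _ _; exact: trmx_mean.
  have JdiffT : uO T 1 (fun h t => (Jac A (mp h t))^T - (Jac A (mm h t))^T).
    by apply: uO_eq (uO_trmx (Jl _ mpm)) => h t _ _; exact/esym/trmx_sub.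
  have T1 := uO_scale 2^-1 (uO_mulmx JmeanT s1 (erefl 3%N)).
  have T2 := uO_mulmx (uO_trmx J0) s3 (erefl 3%N).
  have T3 := uO_scale 2^-1 (uO_mulmx JdiffT s2 (erefl 3%N)).
  apply: uO_eq (uO_add (uO_add T1 T2) T3) => h t _ _.
  rewrite scalemxAr mulmx_mean_split.
  have -> : X h t - P h t + (P h t - Y h t) = X h t - Y h t by rewrite addrA subrK.
  have -> : X h t - P h t - (P h t - Y h t) = X h t + Y h t - 2 *: P h t.
    by apply/matrixP => i j; rewrite !mxE; ring.
  by rewrite !scalerA.
have E2 : uO T 3 (fun h t => A (mp h t) - A (mm h t) - h *: (Jac A (P h t) *m v h t)).
  have T1 := uO_mulmx (JZ _ ZP) mpm (erefl 3%N).
  have T2 := uO_mulmx J0 (uO_scale 2^-1 s3) (erefl 3%N).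
  apply: uO_eq (uO_add (uO_add (Amid mpm) T1) T2) => h t _ _.
  have -> : 2^-1 *: (X h t - Y h t - (2 * h) *: v h t) = (mp h t - mm h t) - h *: v h t.
    by apply/matrixP => i j; rewrite !mxE; field.
  by rewrite scalemxAr; exact: mulmx_diff_split.
have T1 := uO_scale 2^-1 (uO_mulX 1 E1).
have T2 := uO_mulX 1 E2.
have T3 := uO_scale 2^-1 (uO_mulX 2 Fmean).
apply: uO_eq (uO_add (uO_sub T1 T2) T3) => h t _ tt.
have -> : a h t = (Jac A (P h t))^T *m v h t - Jac A (P h t) *m v h t + F (P h t).
  exact: ode.
exact: (FVI_rhs_split h ((Jac A (mp h t))^T *m (X h t - P h t))
  ((Jac A (mm h t))^T *m (P h t - Y h t)) (A (mp h t)) (A (mm h t))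
  (F (mp h t)) (F (mm h t)) (F (P h t))
  ((Jac A (P h t))^T *m v h t) (Jac A (P h t) *m v h t)).
Qed.

Lemma uO_filters n (f : R -> R -> 'cV[R]_3) : uO T n f ->
  uO T n.+2 (fun h t => Psi B0 h *m f h t - f h t) /\
  uO T n.+2 (fun h t => Phi B0 h *m f h t - f h t).
Proof.
have [K K0 HK] := filter_near_id B0; move=> [L L0 HL].
have bd (h t : R) : 0 < h <= 1 -> 0 <= t <= T ->
    K * h ^+ 2 * `|f h t| <= K * L * h ^+ n.+2.
  move=> hh tt; have /andP[/ltW h0 _] := hh.
  have -> : K * L * h ^+ n.+2 = K * h ^+ 2 * (L * h ^+ n).
    by rewrite -[n.+2]/(2 + n)%N exprD; ring.
  by rewrite ler_wpM2l ?HL// mulr_ge0// exprn_ge0.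
by split; exists (K * L) => [|h t hh tt]; rewrite ?mulr_ge0//;
  apply: le_trans (bd h t hh tt); have [] := HK h (f h t) hh.
Qed.

Lemma two_step_defect : uO T 4 (fun h t =>
  X h t - 2 *: P h t + Y h t - Psi B0 h *m FVI_rhs h (Y h t) (P h t) (X h t)).
Proof.
have [_ _ _ s4] := trajectory_expansion; have rhsE := FVI_rhs_expansion.
have rhs2 : uO T 2 (fun h t => FVI_rhs h (Y h t) (P h t) (X h t)).
  apply: uO_eq (uO_add (uO_le (isT : (2 <= 4)%N) rhsE) (uO_mulX 2 a_order0)) => h t _ _.
  by rewrite subrK.
have [psi4 _] := uO_filters rhs2.
apply: uO_eq (uO_sub (uO_sub s4 rhsE) psi4) => h t _ _.
move: (X h t) (Y h t) (P h t) (a h t) (FVI_rhs _ _ _ _) (Psi _ _ *m _) => *.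
by apply/matrixP => i j; rewrite !mxE; ring.
Qed.

Let FVI_start_rhs_split (h : R) (v0 a0 a1 j1 p f0 f1 jv : 'cV[R]_3) :
  v0 + a0 + 2^-1 *: p - a1 + (h / 2) *: f1 - v0 - (h / 2) *: (j1 - jv + f0) =
  2^-1 *: (p - h *: j1) - (a1 - a0 - (h / 2) *: jv) + 2^-1 *: (h ^+ 1 *: (f1 - f0)).
Proof. by apply/matrixP => i j; rewrite !mxE; field. Qed.

(** The momentum contains A(x_0), and A(x_0) - A(x_(1/2)) combines with the
transposed Jacobian term into half a magnetic force, which turns [v] into
v + (h / 2) x''.  The formula being one-sided, the remainder is O(h^2) only. *)
Lemma FVI_start_rhs_expansion : uO T 2 (fun h t =>
  FVI_start_rhs h (P h t) (v h t) (X h t) - v h t - (h / 2) *: a h t).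
Proof.
have [d1 d2 _] := forward_expansion.
have [M [HM J0 calc]] := field_calculus.
have PM (h t : R) (hh : 0 < h <= 1) (tt : 0 <= t <= T) : `|P h t| <= M by case: (HM h t hh tt).
have mpM (h t : R) (hh : 0 < h <= 1) (tt : 0 <= t <= T) : `|mp h t| <= M by case: (HM h t hh tt).
pose Q h t := midpoint (mp h t) (P h t).
have QM (h t : R) (hh : 0 < h <= 1) (tt : 0 <= t <= T) : `|Q h t| <= M.
  rewrite /Q /midpoint normrZ ger0_norm//.
  by have := ler_normD (mp h t) (P h t); have := PM h t hh tt; have := mpM h t hh tt; lra.
have mP : uO T 1 (fun h t => mp h t - P h t).
  apply: uO_eq (uO_scale 2^-1 d1) => h t _ _.
  by apply/matrixP => i j; rewrite !mxE; field.
have QP : uO T 1 (fun h t => Q h t - P h t).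
  apply: uO_eq (uO_scale 4^-1 d1) => h t _ _.
  by apply/matrixP => i j; rewrite !mxE; field.
have [Jl Fl _ _ Amid] := calc _ _ mpM PM.
have [JQ _ _ _ _] := calc _ _ QM PM.
have E1 : uO T 2 (fun h t => (Jac A (mp h t))^T *m (X h t - P h t)
    - h *: ((Jac A (P h t))^T *m v h t)).
  have T1 := uO_mulmx (uO_trmx (Jl _ mP)) d1 (erefl 2%N).
  have T2 := uO_mulmx (uO_trmx J0) d2 (erefl 2%N).
  apply: uO_eq (uO_add T1 T2) => h t _ _.
  by rewrite trmx_sub scalemxAr; exact: mulmx_prod_split.
have E2 : uO T 2 (fun h t => A (mp h t) - A (P h t) - (h / 2) *: (Jac A (P h t) *m v h t)).
  have T1 := uO_mulmx (JQ _ QP) mP (erefl 2%N).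
  have T2 := uO_mulmx J0 (uO_scale 2^-1 d2) (erefl 2%N).
  apply: uO_eq (uO_add (uO_add (uO_le (isT : (2 <= 3)%N) (Amid mP)) T1) T2) => h t _ _.
  have -> : 2^-1 *: (X h t - P h t - h *: v h t) = (mp h t - P h t) - (h / 2) *: v h t.
    by apply/matrixP => i j; rewrite !mxE; field.
  by rewrite scalemxAr; exact: mulmx_diff_split.
have E3 := uO_scale 2^-1 (uO_mulX 1 (Fl _ mP)).
apply: uO_eq (uO_add (uO_sub (uO_scale 2^-1 E1) E2) E3) => h t _ tt.
have -> : a h t = (Jac A (P h t))^T *m v h t - Jac A (P h t) *m v h t + F (P h t).
  exact: ode.
exact: (FVI_start_rhs_split h (v h t) (A (P h t)) (A (mp h t))
  ((Jac A (P h t))^T *m v h t) ((Jac A (mp h t))^T *m (X h t - P h t))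
  (F (P h t)) (F (mp h t)) (Jac A (P h t) *m v h t)).
Qed.

Lemma start_defect : uO T 3 (fun h t =>
  X h t - (P h t + h *: (Psi B0 h *m FVI_start_rhs h (P h t) (v h t) (X h t)))).
Proof.
have [_ _ d3] := forward_expansion; have rhsE := FVI_start_rhs_expansion.
have rhs0 : uO T 0 (fun h t => FVI_start_rhs h (P h t) (v h t) (X h t)).
  have v0 := v_order0; have a0 := uO_scale 2^-1 (uO_le (isT : (0 <= 1)%N) (uO_mulX 1 a_order0)).
  apply: uO_eq (uO_add (uO_le (isT : (0 <= 2)%N) rhsE) (uO_add v0 a0)) => h t _ _.
  move: (v h t) (a h t) (FVI_start_rhs _ _ _ _) => *.
  by apply/matrixP => i j; rewrite !mxE; field.
have [psi2 _] := uO_filters rhs0.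
apply: uO_eq (uO_sub (uO_sub d3 (uO_mulX 1 rhsE)) (uO_mulX 1 psi2)) => h t _ _.
move: (X h t) (P h t) (v h t) (a h t) (FVI_start_rhs _ _ _ _) (Psi _ _ *m _) => *.
by apply/matrixP => i j; rewrite !mxE; field.
Qed.

Lemma velocity_start_defect : uO T 2 (fun h t =>
  2^-1 *: (v h (t + h) + v h t) - Phi B0 h *m (h^-1 *: (X h t - P h t))).
Proof.
have [w2 w3] := velocity_expansion; have [d1 _ d3] := forward_expansion.
have [_ phi2] := uO_filters (uO_div d1).
have T1 := uO_scale 4^-1 (uO_add w2 (uO_le (isT : (2 <= 3)%N) w3)).
apply: uO_eq (uO_sub (uO_sub T1 (uO_div d3)) phi2) => h t /andP[h0 _] _.
move: (v h (t + h)) (v h (t - h)) (X h t) (P h t) (v h t) (a h t) (Phi _ _ *m _) => *.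
by apply/matrixP => i j; rewrite !mxE; field; rewrite gt_eqF.
Qed.

(** Two consecutive velocity relations are subtracted: this removes the O(h^2) part
of the defect, which varies slowly in time. *)
Lemma velocity_defect : uO T 3 (fun h t =>
  2^-1 *: (v h (t + h) - v h (t - h)) - Phi B0 h *m (h^-1 *: (X h t - 2 *: P h t + Y h t))).
Proof.
have [_ w3] := velocity_expansion; have [_ s2 _ s4] := trajectory_expansion.
have [_ phi3] := uO_filters (uO_div s2).
apply: uO_eq (uO_sub (uO_sub (uO_scale 2^-1 w3) (uO_div s4)) phi3) => h t /andP[h0 _] _.
have -> : X h t - 2 *: P h t + Y h t = X h t + Y h t - 2 *: P h t by rewrite addrAC.
move: (v h (t + h)) (v h (t - h)) (X h t) (Y h t) (P h t) (a h t) (Phi _ _ *m _) => *.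
by apply/matrixP => i j; rewrite !mxE; field; rewrite gt_eqF.
Qed.

End consistency.

(** * Stability of the right-hand sides *)

Section stability.
Context {R : realType}.
Variables (A F : 'cV[R]_3 -> 'cV[R]_3) (rho V : R).
Hypothesis V0 : 0 <= V.
Hypothesis HA : Ck 5 A.
Hypothesis HF : Ck 5 F.

Let mid_ball (y z : 'cV[R]_3) : `|y| <= rho -> `|z| <= rho -> `|midpoint y z| <= rho.
Proof.
move=> yr zr; rewrite /midpoint normrZ ger0_norm//.
by have := ler_normD y z; lra.
Qed.

Let mid_dist (y z y' z' : 'cV[R]_3) :
  `|midpoint y z - midpoint y' z'| <= 2^-1 * (`|y - y'| + `|z - z'|).
Proof.
have -> : midpoint y z - midpoint y' z' = 2^-1 *: ((y - y') + (z - z')).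
  by apply/matrixP => i j; rewrite !mxE; field.
by rewrite normrZ ger0_norm// ler_wpM2l// ler_normD.
Qed.

(** Writing M a - N b = M (a - b) + (M - N) b lets position errors enter only
multiplied by [b], the O(h) increment of the exact solution, so that the bound
holds for numerical increments [a] of any size. *)
Lemma Jac_term_stability : exists2 K, 0 <= K &
  forall y z a b : 'cV[R]_3, `|y| <= rho -> `|z| <= rho ->
    `|(Jac A y)^T *m a - (Jac A z)^T *m b| <= K * (`|a - b| + `|y - z| * `|b|).
Proof.
have [K K0 [J1 J2 _]] := Jac_bounds rho HA.
exists (3 * K) => [|y z a b yr zr]; first by rewrite mulr_ge0.
rewrite distrC mulmx_prod_split; apply: le_trans (ler_normD _ _) _.
rewrite addrC mulrDr lerD//.
  apply: le_trans (norm_mulmx _ _) _; rewrite distrC ler_wpM2r// ler_wpM2l//.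
  exact: le_trans (trmx_norm_le _) (J1 _ yr).
apply: le_trans (norm_mulmx _ _) _; rewrite mulrA ler_wpM2r// -mulrA ler_wpM2l//.
rewrite -trmx_sub; apply: le_trans (trmx_norm_le _) _.
by rewrite distrC; exact: J2.
Qed.

Let rhs_combination (h K1 K2 K3 g p q : R)
    (J1 L1 J2 L2 a1 a2 b1 b2 f1 f2 g1 g2 : 'cV[R]_3) : 0 < h <= 1 ->
  0 <= K1 -> 0 <= K2 -> 0 <= K3 -> 0 <= g -> 0 <= p -> 0 <= q ->
  `|J1 - L1| <= K1 * (p + V * (h * g)) ->
  `|J2 - L2| <= K1 * (q + V * (h * g)) ->
  `|a1 - a2 - (b1 - b2)| <= K2 * (2^-1 * (p + q) + 2 * (V * (h * g))) ->
  `|f1 - g1| <= K3 * g -> `|f2 - g2| <= K3 * g ->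
  `|(h / 2) *: J1 + (h / 2) *: J2 - h *: (a1 - a2) + (h ^+ 2 / 2) *: (f1 + f2)
    - ((h / 2) *: L1 + (h / 2) *: L2 - h *: (b1 - b2) + (h ^+ 2 / 2) *: (g1 + g2))|
  <= (K1 + K2 + K3) * (3 + 5 * V) * h * (p + q + h * g).
Proof.
move=> /andP[h0 h1] K10 K20 K30 g0 p0 q0 C1 C2 C3 C4 C5.
have -> : (h / 2) *: J1 + (h / 2) *: J2 - h *: (a1 - a2) + (h ^+ 2 / 2) *: (f1 + f2)
    - ((h / 2) *: L1 + (h / 2) *: L2 - h *: (b1 - b2) + (h ^+ 2 / 2) *: (g1 + g2))
  = h *: (2^-1 *: (J1 - L1) + 2^-1 *: (J2 - L2) - (a1 - a2 - (b1 - b2))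
    + (h / 2) *: ((f1 - g1) + (f2 - g2))).
  by apply/matrixP => i j; rewrite !mxE; field.
have hh2 : `|h / 2| = h / 2 by rewrite ger0_norm// divr_ge0// ltW.
rewrite normrZ (gtr0_norm h0) mulrAC [leRHS]mulrC ler_wpM2l ?(ltW h0)//.
apply: le_trans (ler_normD _ _) _; rewrite normrZ hh2.
have T1 := ler_normB (2^-1 *: (J1 - L1) + 2^-1 *: (J2 - L2)) (a1 - a2 - (b1 - b2)).
have := ler_normD (2^-1 *: (J1 - L1)) (2^-1 *: (J2 - L2)).
rewrite !normrZ (ger0_norm (_ : 0 <= 2^-1 :> R))// => T2.
have T3 := ler_normD (f1 - g1) (f2 - g2).
have T4 : h / 2 * `|f1 - g1 + (f2 - g2)| <= h / 2 * (K3 * g + K3 * g).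
  by rewrite ler_wpM2l ?divr_ge0 ?(ltW h0)//; lra.
have E : h / 2 * (K3 * g + K3 * g) = K3 * (h * g) by field.
rewrite E in T4.
have s0 : 0 <= h * g by rewrite mulr_ge0// ltW.
move: (h * g) s0 C1 C2 C3 T4 => s s0 C1 C2 C3 T4.
have W0 : 0 <= V * s by rewrite mulr_ge0.
have X1 : 0 <= K1 * (V * s) by rewrite mulr_ge0.
have X2 : 0 <= K2 * (V * s) by rewrite mulr_ge0.
have X3 : 0 <= K3 * (V * s) by rewrite mulr_ge0.
have Y1 : 0 <= K1 * s by rewrite mulr_ge0.
have Y2 : 0 <= K2 * s by rewrite mulr_ge0.
have Y3 : 0 <= K3 * s by rewrite mulr_ge0.
have Z0 : 0 <= (p + q) by rewrite addr_ge0.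
have Z1 : 0 <= K1 * (p + q) by rewrite mulr_ge0.
have Z2 : 0 <= K2 * (p + q) by rewrite mulr_ge0.
have Z3 : 0 <= K3 * (p + q) by rewrite mulr_ge0.
have U1 : 0 <= V * (K1 * (p + q)) by rewrite mulr_ge0.
have U2 : 0 <= V * (K2 * (p + q)) by rewrite mulr_ge0.
have U3 : 0 <= V * (K3 * (p + q)) by rewrite mulr_ge0.
have -> : (K1 + K2 + K3) * (3 + 5 * V) * (p + q + s) =
  3 * (K1 * (p + q)) + 3 * (K2 * (p + q)) + 3 * (K3 * (p + q))
  + 3 * (K1 * s) + 3 * (K2 * s) + 3 * (K3 * s)
  + 5 * (V * (K1 * (p + q))) + 5 * (V * (K2 * (p + q))) + 5 * (V * (K3 * (p + q)))
  + 5 * (K1 * (V * s)) + 5 * (K2 * (V * s)) + 5 * (K3 * (V * s)) by ring.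
have D1 : K1 * (p + V * s) + K1 * (q + V * s) = K1 * (p + q) + 2 * (K1 * (V * s)) by ring.
have D2 : K2 * (2^-1 * (p + q) + 2 * (V * s)) =
  2^-1 * (K2 * (p + q)) + 2 * (K2 * (V * s)) by ring.
lra.
Qed.

Let start_combination (h K1 K2 K3 p : R) (u j1 l1 a1 b1 f1 g1 : 'cV[R]_3) :
  0 < h <= 1 -> 0 <= K1 -> 0 <= K2 -> 0 <= K3 -> 0 <= p ->
  `|j1 - l1| <= K1 * (p + p * V) -> `|a1 - b1| <= K2 * p -> `|f1 - g1| <= K3 * p ->
  `|u + 2^-1 *: j1 - a1 + (h / 2) *: f1 - (u + 2^-1 *: l1 - b1 + (h / 2) *: g1)|
  <= (K1 * (1 + V) + K2 + K3) * p.
Proof.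
move=> /andP[h0 h1] K10 K20 K30 p0 C1 C2 C3.
have -> : u + 2^-1 *: j1 - a1 + (h / 2) *: f1 - (u + 2^-1 *: l1 - b1 + (h / 2) *: g1)
    = 2^-1 *: (j1 - l1) - (a1 - b1) + (h / 2) *: (f1 - g1).
  by apply/matrixP => i j; rewrite !mxE; field.
have T1 := ler_normD (2^-1 *: (j1 - l1) - (a1 - b1)) ((h / 2) *: (f1 - g1)).
have := ler_normB (2^-1 *: (j1 - l1)) (a1 - b1).
have h20 : 0 <= h / 2 by rewrite divr_ge0// ltW.
rewrite !normrZ (ger0_norm (_ : 0 <= 2^-1 :> R))// => T2.
rewrite normrZ (ger0_norm h20) in T1.
have T3 : h / 2 * `|f1 - g1| <= `|f1 - g1| by rewrite ler_piMl//; lra.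
have p1 : 0 <= K1 * (p + p * V) by rewrite mulr_ge0// addr_ge0// mulr_ge0.
have -> : (K1 * (1 + V) + K2 + K3) * p = K1 * (p + p * V) + K2 * p + K3 * p by ring.
lra.
Qed.

Let geometry (h : R) (y1 y2 y3 z1 z2 z3 : 'cV[R]_3) :
  let p := `|(y3 - z3) - (y2 - z2)| in
  let q := `|(y2 - z2) - (y1 - z1)| in
  let g := `|y1 - z1| + `|y2 - z2| + `|y3 - z3| in
  `|z3 - z2| <= V * h -> `|z2 - z1| <= V * h ->
  [/\ `|midpoint y2 y3 - midpoint z2 z3| <= g,
      `|midpoint y2 y1 - midpoint z2 z1| <= g,
      `|midpoint y2 y3 - midpoint y2 y1 - (midpoint z2 z3 - midpoint z2 z1)|
        <= 2^-1 * (p + q)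
    & `|midpoint z2 z3 - midpoint z2 z1| <= V * h].
Proof.
move=> p q g zp zm.
have [n1 n2 n3] : [/\ 0 <= `|y1 - z1|, 0 <= `|y2 - z2| & 0 <= `|y3 - z3|] by [].
split.
- by apply: le_trans (mid_dist _ _ _ _) _; rewrite /g; lra.
- by apply: le_trans (mid_dist _ _ _ _) _; rewrite /g; lra.
- rewrite (_ : midpoint y2 y3 - _ - _ =
    2^-1 *: ((y3 - z3 - (y2 - z2)) + (y2 - z2 - (y1 - z1)))); last first.
    by apply/matrixP => i j; rewrite !mxE; field.
  by rewrite normrZ ger0_norm// ler_wpM2l// ler_normD.
- rewrite (_ : midpoint z2 z3 - _ = 2^-1 *: ((z3 - z2) + (z2 - z1))); last first.
    by apply/matrixP => i j; rewrite !mxE; field.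
  by rewrite normrZ ger0_norm//; have := ler_normD (z3 - z2) (z2 - z1); lra.
Qed.

(** The numerical points are [y1], [y2], [y3], the exact ones [z1], [z2], [z3].
Differences of successive errors enter with the factor [h], the errors themselves
with [h ^+ 2]: after division by [h] this is a first-order recursion for the
difference quotients of the error. *)
Lemma FVI_rhs_stability : exists2 K, 0 <= K &
  forall h (y1 y2 y3 z1 z2 z3 : 'cV[R]_3), 0 < h <= 1 ->
    `|y1| <= rho -> `|y2| <= rho -> `|y3| <= rho ->
    `|z1| <= rho -> `|z2| <= rho -> `|z3| <= rho ->
    `|z3 - z2| <= V * h -> `|z2 - z1| <= V * h ->
    `|FVI_rhs A F h y1 y2 y3 - FVI_rhs A F h z1 z2 z3| <= K * h *
      (`|(y3 - z3) - (y2 - z2)| + `|(y2 - z2) - (y1 - z1)|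
       + h * (`|y1 - z1| + `|y2 - z2| + `|y3 - z3|)).
Proof.
have [K1 K10 H1] := Jac_term_stability.
have [K2 K20 H2] := second_difference rho (@col_frame R 3) HA.
have [K3 K30 H3] := smooth_lipschitz rho (@col_frame R 3) (Ck_le (isT : (4 <= 5)%N) HF).
exists ((K1 + K2 + K3) * (3 + 5 * V)) => [|h y1 y2 y3 z1 z2 z3 hh y1r y2r y3r z1r z2r z3r].
  by rewrite mulr_ge0 ?addr_ge0// mulr_ge0.
move=> zp zm; have [dp dm E3 E4] := geometry y1 y2 y3 zp zm.
have swap (u1 u2 u3 u4 : 'cV[R]_3) : u1 - u2 - (u3 - u4) = u1 - u3 - (u2 - u4).
  by apply/matrixP => i j; rewrite !mxE; ring.
have ypr := mid_ball y2r y3r; have ymr := mid_ball y2r y1r.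
have wpr := mid_ball z2r z3r; have wmr := mid_ball z2r z1r.
have hn (g : R) : V * (h * g) = g * (V * h) by ring.
have G3 := ler_pM (addr_ge0 (normr_ge0 _) (normr_ge0 _)) (normr_ge0 _) (lerD dp dm) E4.
have E1 : `|y3 - y2 - (z3 - z2)| = `|y3 - z3 - (y2 - z2)| by rewrite swap.
have E2 : `|y2 - y1 - (z2 - z1)| = `|y2 - z2 - (y1 - z1)| by rewrite swap.
have g0 : 0 <= `|y1 - z1| + `|y2 - z2| + `|y3 - z3| by rewrite !addr_ge0.
apply: (rhs_combination hh K10 K20 K30 g0 (normr_ge0 _) (normr_ge0 _)).
- apply: le_trans (H1 _ _ _ _ ypr wpr) _; rewrite E1.
  apply: (ler_wpM2l K10); apply: lerD (lexx _) _; rewrite hn.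
  exact: (ler_pM (normr_ge0 _) (normr_ge0 _) dp zp).
- apply: le_trans (H1 _ _ _ _ ymr wmr) _; rewrite E2.
  apply: (ler_wpM2l K10); apply: lerD (lexx _) _; rewrite hn.
  exact: (ler_pM (normr_ge0 _) (normr_ge0 _) dm zm).
- apply: le_trans (H2 _ _ _ _ ypr ymr wpr wmr) _.
  apply: (ler_wpM2l K20); apply: (lerD E3); apply: le_trans G3 _.
  by rewrite hn mulrA mulr_natl mulr2n; exact: lexx.
- exact: le_trans (H3 _ _ ypr wpr) (ler_wpM2l K30 dp).
- exact: le_trans (H3 _ _ ymr wmr) (ler_wpM2l K30 dm).
Qed.

Lemma FVI_start_rhs_stability : exists2 K, 0 <= K &
  forall h (x0 v0 y z : 'cV[R]_3), 0 < h <= 1 ->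
    `|x0| <= rho -> `|y| <= rho -> `|z| <= rho -> `|z - x0| <= V ->
    `|FVI_start_rhs A F h x0 v0 y - FVI_start_rhs A F h x0 v0 z| <= K * `|y - z|.
Proof.
have [K1 K10 H1] := Jac_term_stability.
have [K2 K20 H2] := smooth_lipschitz rho (@col_frame R 3) (Ck_le (isT : (4 <= 5)%N) HA).
have [K3 K30 H3] := smooth_lipschitz rho (@col_frame R 3) (Ck_le (isT : (4 <= 5)%N) HF).
exists (K1 * (1 + V) + K2 + K3) => [|h x0 v0 y z hh x0r yr zr zV].
  by rewrite !addr_ge0// mulr_ge0// addr_ge0.
have ypr := mid_ball x0r yr; have zpr := mid_ball x0r zr.
have dyz : `|midpoint x0 y - midpoint x0 z| <= `|y - z|.
  apply: le_trans (mid_dist _ _ _ _) _; rewrite subrr normr0 add0r.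
  by have := normr_ge0 (y - z); lra.
have E1 : `|y - x0 - (z - x0)| = `|y - z|.
  by congr (`|_|); apply/matrixP => i j; rewrite !mxE; ring.
have C1 := H1 _ _ (y - x0) (z - x0) ypr zpr; rewrite E1 in C1.
have C1' := le_trans C1 (ler_wpM2l K10
  (lerD (lexx _) (ler_pM (normr_ge0 _) (normr_ge0 _) dyz zV))).
have C2 := le_trans (H2 _ _ ypr zpr) (ler_wpM2l K20 dyz).
have C3 := le_trans (H3 _ _ ypr zpr) (ler_wpM2l K30 dyz).
exact: start_combination hh K10 K20 K30 (normr_ge0 _) C1' C2 C3.
Qed.

End stability.

(** * Error recursions *)

Section local_errors.
Context {R : realType}.
Variables (T : R) (B0 : 'cV[R]_3) (A F : 'cV[R]_3 -> 'cV[R]_3) (x : R -> 'cV[R]_3).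
Hypothesis T0 : 0 < T.
Hypothesis HA : Ck 5 A.
Hypothesis HF : Ck 5 F.
Hypothesis Hx : Ck 5 (x : R^o -> 'cV[R]_3).
Hypothesis ode : forall t, 0 <= t <= T ->
  derive1n 2 x t = (Jac A (x t))^T *m derive1 x t - Jac A (x t) *m derive1 x t + F (x t).

Lemma filters_bounded : exists2 K, 0 <= K &
  forall (h : R) (w : 'cV[R]_3), 0 < h <= 1 ->
    `|Psi B0 h *m w| <= K * `|w| /\ `|Phi B0 h *m w| <= K * `|w|.
Proof.
have [K K0 HK] := filter_near_id B0; exists (1 + K) => [|h w hh]; first exact: addr_ge0.
have [H1 H2] := HK h w hh; have /andP[/ltW h0 h1] := hh.
have hw : K * h ^+ 2 * `|w| <= K * `|w|.
  by rewrite ler_wpM2r// ler_piMr// expr_le1.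
have near_w (u : 'cV[R]_3) : `|u - w| <= K * h ^+ 2 * `|w| -> `|u| <= (1 + K) * `|w|.
  move=> uw; have := ler_normD (u - w) w; rewrite subrK mulrDl mul1r; lra.
by split; exact: near_w.
Qed.

Let step_split (P : 'M[R]_3) (y1 y2 y3 z1 z2 z3 r q : 'cV[R]_3) :
  y3 - 2 *: y2 + y1 = P *m r ->
  (y3 - z3) - 2 *: (y2 - z2) + (y1 - z1) =
  P *m (r - q) - (z3 - 2 *: z2 + z1 - P *m q).
Proof.
move=> E; rewrite mulmxBr -E; move: (P *m q) => *.
by apply/matrixP => i j; rewrite !mxE; ring.
Qed.

(** The hypotheses on [y1], [y2] and on the length of the last step confine all
points to a ball fixed in advance, so [S] and [K] do not depend on the step. *)
Lemma two_step_error (r : R) : 0 <= r -> exists S K, [/\ 0 <= S, 0 <= K &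
  forall h t (y1 y2 y3 : 'cV[R]_3), 0 < h <= 1 -> h <= t <= T ->
    FVI_step B0 A F h y1 y2 y3 ->
    `|y1 - x (t - h)| <= 1 -> `|y2 - x t| <= 1 -> `|y3 - y2| <= r ->
    `|(y3 - x (t + h)) - 2 *: (y2 - x t) + (y1 - x (t - h))| <=
      S * h * (`|(y3 - x (t + h)) - (y2 - x t)| + `|(y2 - x t) - (y1 - x (t - h))|
        + h * (`|y1 - x (t - h)| + `|y2 - x t| + `|y3 - x (t + h)|))
      + K * h ^+ 4].
Proof.
move=> r0; have [M M0 HM] := trajectory_bounded T Hx.
have [[V V0 HV] _ _] := forward_expansion T Hx.
have [KS KS0 HS] := FVI_rhs_stability (M + 1 + r) V0 HA HF.
have [KP KP0 HP] := filters_bounded.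
have [K K0 HK] := two_step_defect B0 HA HF Hx ode.
exists (KP * KS), K; split=> // [|h t y1 y2 y3 hh /andP[ht tT] step e1 e2 e3].
  exact: mulr_ge0.
have /andP[h0 h1] := hh.
have tt : 0 <= t <= T by apply/andP; split; lra.
have tt' : 0 <= t - h <= T by apply/andP; split; lra.
have xb s : - (T + 1) <= s <= T + 1 -> `|x s| <= M.
  by rewrite -ler_norml => /HM[].
have [z1 z2 z3] : [/\ `|x (t - h)| <= M, `|x t| <= M & `|x (t + h)| <= M].
  by split; apply: xb; apply/andP; split; lra.
have close (y z : 'cV[R]_3) (c d : R) : `|y - z| <= c -> `|z| <= d -> `|y| <= d + c.
  by move=> yz zd; have := ler_normD (y - z) z; rewrite subrK; lra.
have b1 := close _ _ _ _ e1 z1; have b2 := close _ _ _ _ e2 z2.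
have b3 := close _ _ _ _ e3 b2.
have Vp := HV h t hh tt; have Vm := HV h (t - h) hh tt'.
rewrite expr1 in Vp; rewrite expr1 subrK in Vm.
have wide c : c <= M + 1 -> c <= M + 1 + r by lra.
have wide' c : c <= M -> c <= M + 1 + r by lra.
have stab := HS h y1 y2 y3 (x (t - h)) (x t) (x (t + h)) hh (wide _ b1) (wide _ b2) b3
  (wide' _ z1) (wide' _ z2) (wide' _ z3) Vp Vm.
rewrite (step_split (x (t - h)) (x t) (x (t + h))
  (FVI_rhs A F h (x (t - h)) (x t) (x (t + h))) step).
apply: le_trans (ler_normB _ _) _; apply: lerD; last exact: HK h t hh tt.
apply: le_trans (HP h _ hh).1 _; rewrite -[KP * KS * h]mulrA -mulrA.
exact: ler_wpM2l KP0 _ _ stab.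
Qed.

Let start_split (P : 'M[R]_3) (h : R) (y z z0 r q : 'cV[R]_3) :
  y = z0 + h *: (P *m r) ->
  y - z = h *: (P *m (r - q)) - (z - (z0 + h *: (P *m q))).
Proof.
move=> E; rewrite mulmxBr {1}E; move: (P *m q) (P *m r) => *.
by apply/matrixP => i j; rewrite !mxE; ring.
Qed.

(** The formula for x_1 is implicit; the error appears on the right with a factor
[h] and is absorbed on the left for small [h]. *)
Lemma start_error (r : R) : 0 <= r -> exists S K, [/\ 0 <= S, 0 <= K &
  forall h (y : 'cV[R]_3), 0 < h <= 1 ->
    FVI_start B0 A F h (x 0) (derive1 x 0) y -> `|y - x 0| <= r ->
    `|y - x h| <= S * h * `|y - x h| + K * h ^+ 3].
Proof.
move=> r0; have [M M0 HM] := trajectory_bounded T Hx.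
have [[V V0 HV] _ _] := forward_expansion T Hx.
have [KS KS0 HS] := FVI_start_rhs_stability (M + r) V0 HA HF.
have [KP KP0 HP] := filters_bounded.
have [K K0 HK] := start_defect B0 HA HF Hx ode.
exists (KP * KS), K; split=> // [|h y hh start e0]; first exact: mulr_ge0.
have /andP[h0 h1] := hh.
have tt : 0 <= (0 : R) <= T by rewrite lexx ltW.
have xb s : - (T + 1) <= s <= T + 1 -> `|x s| <= M.
  by rewrite -ler_norml => /HM[].
have [z0 z1] : `|x 0| <= M /\ `|x h| <= M.
  by split; apply: xb; apply/andP; split; lra.
have b : `|y| <= M + r.
  by have := ler_normD (y - x 0) (x 0); rewrite subrK; lra.
have Vp := HV h 0 hh tt; rewrite expr1 add0r in Vp.
have Vp' : `|x h - x 0| <= V by apply: le_trans Vp _; rewrite ler_piMr.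
have wide c : c <= M -> c <= M + r by lra.
have stab := HS h (x 0) (derive1 x 0) y (x h) hh (wide _ z0) b (wide _ z1) Vp'.
rewrite {1}(start_split (x h) (FVI_start_rhs A F h (x 0) (derive1 x 0) (x h)) start).
apply: le_trans (ler_normB _ _) _; apply: lerD.
  rewrite normrZ (gtr0_norm h0) (mulrC (_ * _) h) -!mulrA; apply: (ler_wpM2l (ltW h0)).
  exact: le_trans (HP h _ hh).1 (ler_wpM2l KP0 stab).
by have := HK h 0 hh tt; rewrite add0r.
Qed.

Let velocity_start_split (P : 'M[R]_3) (h : R) (w v0 v1 y x0 x1 : 'cV[R]_3) :
  2^-1 *: (w + v0) = P *m (h^-1 *: (y - x0)) ->
  w - v1 = 2 *: (P *m (h^-1 *: (y - x1))
    - (2^-1 *: (v1 + v0) - P *m (h^-1 *: (x1 - x0)))).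
Proof.
move=> E; have -> : P *m (h^-1 *: (y - x1)) =
    2^-1 *: (w + v0) - P *m (h^-1 *: (x1 - x0)).
  by rewrite E -mulmxBr -scalerBr opprB addrA subrK.
by move: (P *m _) => *; apply/matrixP => i j; rewrite !mxE; field.
Qed.

Lemma velocity_start_error : exists S K, [/\ 0 <= S, 0 <= K &
  forall h (y w : 'cV[R]_3), 0 < h <= 1 ->
    FVI_velocity B0 h (x 0) y (derive1 x 0) w ->
    `|w - derive1 x h| <= S * (h^-1 * `|y - x h|) + K * h ^+ 2].
Proof.
have [KP KP0 HP] := filters_bounded.
have [K K0 HK] := velocity_start_defect T B0 Hx.
exists (2 * KP), (2 * K); split=> [||h y w hh vel]; [exact: mulr_ge0|exact: mulr_ge0|].
have /andP[h0 h1] := hh.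
have tt : 0 <= (0 : R) <= T by rewrite lexx ltW.
have D := HK h 0 hh tt; rewrite add0r in D.
have [_ Hphi] := HP h (h^-1 *: (y - x h)) hh.
rewrite normrZ ger0_norm ?invr_ge0 ?(ltW h0)// in Hphi.
rewrite (velocity_start_split (derive1 x h) (x h) vel) normrZ ger0_norm//.
rewrite -!mulrA -mulrDr; apply: ler_wpM2l => //.
exact: le_trans (ler_normB _ _) (lerD Hphi D).
Qed.

Let velocity_split (P : 'M[R]_3) (h : R) (w1 w2 w3 u1 u3 y1 y2 y3 z1 z2 z3 : 'cV[R]_3) :
  2^-1 *: (w2 + w1) = P *m (h^-1 *: (y2 - y1)) ->
  2^-1 *: (w3 + w2) = P *m (h^-1 *: (y3 - y2)) ->
  (w3 - u3) - (w1 - u1) =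
  2 *: (P *m (h^-1 *: ((y3 - z3) - 2 *: (y2 - z2) + (y1 - z1)))
    - (2^-1 *: (u3 - u1) - P *m (h^-1 *: (z3 - 2 *: z2 + z1)))).
Proof.
move=> E1 E2; have -> : P *m (h^-1 *: ((y3 - z3) - 2 *: (y2 - z2) + (y1 - z1))) =
    2^-1 *: (w3 + w2) - 2^-1 *: (w2 + w1) - P *m (h^-1 *: (z3 - 2 *: z2 + z1)).
  rewrite E1 E2 -!mulmxBr -!scalerBr; congr (P *m (h^-1 *: _)).
  by apply/matrixP => i j; rewrite !mxE; ring.
by move: (P *m _) => *; apply/matrixP => i j; rewrite !mxE; field.
Qed.

Lemma velocity_error : exists S K, [/\ 0 <= S, 0 <= K &
  forall h t (y1 y2 y3 w1 w2 w3 : 'cV[R]_3), 0 < h <= 1 -> 0 <= t <= T ->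
    FVI_velocity B0 h y1 y2 w1 w2 -> FVI_velocity B0 h y2 y3 w2 w3 ->
    `|(w3 - derive1 x (t + h)) - (w1 - derive1 x (t - h))| <=
      S * (h^-1 * `|(y3 - x (t + h)) - 2 *: (y2 - x t) + (y1 - x (t - h))|)
      + K * h ^+ 3].
Proof.
have [KP KP0 HP] := filters_bounded.
have [K K0 HK] := velocity_defect T B0 Hx.
exists (2 * KP), (2 * K); split=> [||h t y1 y2 y3 w1 w2 w3 hh tt vel1 vel2];
  [exact: mulr_ge0|exact: mulr_ge0|].
have /andP[h0 h1] := hh.
have D := HK h t hh tt.
have [_ Hphi] := HP h (h^-1 *: ((y3 - x (t + h)) - 2 *: (y2 - x t) + (y1 - x (t - h)))) hh.
rewrite normrZ (ger0_norm (_ : 0 <= h^-1)) ?invr_ge0 ?(ltW h0)// in Hphi.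
rewrite (velocity_split (derive1 x (t - h)) (derive1 x (t + h))
  (x (t - h)) (x t) (x (t + h)) vel1 vel2) normrZ ger0_norm//.
rewrite -!mulrA -mulrDr; apply: ler_wpM2l => //.
exact: le_trans (ler_normB _ _) (lerD Hphi D).
Qed.

End local_errors.

(** * Discrete Gronwall argument *)

Section discrete.
Context {R : realType}.

(** The hypothesis that a step may only be taken while [W n <= 1] is harmless: the
conclusion guarantees it as soon as [h] is small, so it propagates by induction. *)
Lemma gronwall (T K h : R) (W : nat -> R) : 0 <= K -> 0 < h ->
  W 0%N <= K * h ^+ 2 ->
  (forall n : nat, n.+1%:R * h <= T -> W n <= 1 ->
    W n.+1 <= (1 + K * h) * W n + K * h ^+ 3) ->
  expR (K * T) * (K + K * T) * h ^+ 2 <= 1 ->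
  forall n : nat, n%:R * h <= T -> W n <= expR (K * T) * (K + K * T) * h ^+ 2.
Proof.
move=> K0 h0 W0 step small.
have Kh : 0 <= K * h by rewrite mulr_ge0// ltW.
have q1 : 1 <= 1 + K * h by rewrite lerDl.
have [kh2 kh3] : 0 <= K * h ^+ 2 /\ 0 <= K * h ^+ 3.
  by split; rewrite mulr_ge0// exprn_ge0// ltW.
have growth_le n : n%:R * h <= T ->
    (1 + K * h) ^+ n * (K * h ^+ 2 + n%:R * (K * h ^+ 3)) <=
    expR (K * T) * (K + K * T) * h ^+ 2.
  move=> nT; rewrite -mulrA; apply: ler_pM.
  - by rewrite exprn_ge0// (le_trans ler01).
  - by rewrite addr_ge0// mulr_ge0.
  - apply: (@le_trans _ _ (expR (K * h) ^+ n)).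
      by rewrite lerXn2r ?nnegrE ?expR_ge0 ?expR_ge1Dx// (le_trans ler01).
    by rewrite -expRM_natl ler_expR mulrCA ler_wpM2l.
  - rewrite mulrDl lerD2l (_ : _ * _ = K * (n%:R * h) * h ^+ 2); last by ring.
    by rewrite ler_wpM2r ?exprn_ge0 ?(ltW h0)// ler_wpM2l.
suff sharp n : n%:R * h <= T ->
    W n <= (1 + K * h) ^+ n * (K * h ^+ 2 + n%:R * (K * h ^+ 3)).
  by move=> n nT; exact: le_trans (sharp n nT) (growth_le n nT).
elim: n => [_|n IH nT]; first by rewrite expr0 mul1r mul0r addr0.
have nT' : n%:R * h <= T by apply: le_trans nT; rewrite ler_pM2r// ler_nat.
have Wn := IH nT'; have Wn1 := le_trans Wn (le_trans (growth_le n nT') small).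
apply: le_trans (step n nT Wn1) _.
have p1 : 1 <= (1 + K * h) ^+ n.+1 by rewrite exprn_ege1.
apply: (@le_trans _ _ ((1 + K * h) * ((1 + K * h) ^+ n * (K * h ^+ 2 + n%:R * (K * h ^+ 3)))
    + (1 + K * h) ^+ n.+1 * (K * h ^+ 3))).
  by rewrite lerD ?ler_peMl// ler_wpM2l// (le_trans ler01).
by rewrite (exprS (1 + K * h)) -natr1 le_eqVlt; apply/orP; left; apply/eqP; ring.
Qed.

(** Here [k] is K h.  The recursion for [d1] is implicit; (1 - k)^-1 (1 + h + k) is
at most 1 + 2 h + 4 k for k <= 1/2. *)
Lemma error_step (h k e0 e1 d0 d1 s : R) : 0 <= h -> 0 <= k <= 2^-1 ->
  0 <= e0 -> 0 <= e1 -> 0 <= d0 -> 0 <= d1 -> 0 <= s ->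
  e1 <= e0 + h * d0 -> d1 <= d0 + k * (d1 + d0 + e1) + s ->
  e1 + d1 <= (1 + 2 * h + 4 * k) * (e0 + d0) + 2 * s.
Proof.
move=> h0 /andP[k0 k1] e00 e10 d00 d10 s0 He Hd.
have kp : 0 < 1 - k by lra.
rewrite -(ler_pM2l kp).
have w0 : 0 <= e0 + d0 by rewrite addr_ge0.
have H1 : (1 - k) * (e1 + d1) <= (1 + h + k) * (e0 + d0) + s.
  have a1 : 0 <= h * e0 by rewrite mulr_ge0.
  have a2 : 0 <= k * e0 by rewrite mulr_ge0.
  have -> : (1 - k) * (e1 + d1) = e1 + d1 - k * (d1 + d0 + e1) + k * d0 by ring.
  have -> : (1 + h + k) * (e0 + d0) = e0 + h * d0 + d0 + k * d0 + h * e0 + k * e0 by ring.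
  lra.
apply: le_trans H1 _.
have a3 : 1 + h + k <= (1 - k) * (1 + 2 * h + 4 * k).
  have : 0 <= k * (1 - 2 * k) by rewrite mulr_ge0//; lra.
  have : 0 <= h * (1 - 2 * k) by rewrite mulr_ge0//; lra.
  have -> : (1 - k) * (1 + 2 * h + 4 * k) =
    1 + h + k + 2 * (k * (1 - 2 * k)) + h * (1 - 2 * k) by ring.
  lra.
have a4 := ler_wpM2r w0 a3.
have a5 : s <= (1 - k) * (2 * s).
  have : 0 <= s * (1 - 2 * k) by rewrite mulr_ge0//; lra.
  have -> : (1 - k) * (2 * s) = s + s * (1 - 2 * k) by ring.
  lra.
by rewrite [leRHS]mulrDr mulrA lerD.
Qed.

(** [E], [D] and [Q] stand for |e_n|, |d_n| and |d_(n+1) - d_n|, and [f] for the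
velocity errors; the constants [S1 ... K4] come from the four local error bounds. *)
Lemma discrete_convergence (T S1 K1 S2 K2 S3 K3 S4 K4 : R) :
  0 < T -> 0 <= S1 -> 0 <= K1 -> 0 <= S2 -> 0 <= K2 ->
  0 <= S3 -> 0 <= K3 -> 0 <= S4 -> 0 <= K4 ->
  exists h0 C, [/\ 0 < h0 <= 1, 0 < C & forall h, 0 < h <= h0 ->
  forall E D Q f : nat -> R,
    (forall n, [/\ 0 <= E n, 0 <= D n & 0 <= Q n]) ->
    (forall n, [/\ E n.+1 <= E n + h * D n, E n <= E n.+1 + h * D n
      & D n.+1 <= D n + Q n]) ->
    E 0%N = 0 -> f 0%N = 0 ->
    D 0%N = h^-1 * E 1%N -> E 1%N <= S2 * h * E 1%N + K2 * h ^+ 3 ->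
    (forall n : nat, n.+1%:R * h <= T -> E n <= 1 -> E n.+1 <= 1 ->
      Q n <= S1 * h * (D n.+1 + D n + (E n + E n.+1 + E n.+2)) + K1 * h ^+ 3) ->
    f 1%N <= S3 * (h^-1 * E 1%N) + K3 * h ^+ 2 ->
    (forall n : nat, n.+1%:R * h <= T -> f n.+2 <= f n + S4 * Q n + K4 * h ^+ 3) ->
    forall n : nat, n%:R * h <= T -> E n.+1 <= C * h ^+ 2 /\ f n.+1 <= C * h ^+ 2].
Proof.
move=> T0 S10 K10 S20 K20 S30 K30 S40 K40.
pose K := 2 + 12 * S1 + 2 * K1 + 2 * K2.
have K0 : 0 <= K by rewrite /K; lra.
pose G := expR (K * T) * (K + K * T).
have G0 : 0 <= G by rewrite mulr_ge0 ?expR_ge0// addr_ge0// mulr_ge0// ltW.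
(* h <= 1 / b makes h <= 1, the implicit coefficients 3 S1 h and S2 h at most 1/2,
   and G h^2 <= 1, which closes the bootstrap. *)
pose b := 1 + 6 * S1 + 2 * S2 + G.
have b0 : 1 <= b by rewrite /b; lra.
have bp : 0 < b by exact: lt_le_trans b0.
pose L := S3 * (2 * K2) + K3.
have L0 : 0 <= L by rewrite addr_ge0// mulr_ge0// mulr_ge0.
pose U := S4 * (9 * S1 * G + K1) + K4.
have U0 : 0 <= U by rewrite addr_ge0// mulr_ge0// addr_ge0// mulr_ge0// mulr_ge0.
exists b^-1, (1 + G + L + T * U); split.
- by rewrite invr_gt0 bp invf_le1.
- by have := mulr_ge0 (ltW T0) U0; lra.
move=> h /andP[h0 hb] E D Q f nonneg incr E0 f0 D0 start twostep f1 fstep.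
have hb1 : h * b <= 1 by rewrite -ler_pdivlMr// mul1r.
have [hS1 hS2 hG] : [/\ 0 <= S1 * h, 0 <= S2 * h & 0 <= G * h].
  by split; rewrite mulr_ge0// ltW.
have hbE : h + 6 * (S1 * h) + 2 * (S2 * h) + G * h <= 1.
  by move: hb1; rewrite /b (_ : h * _ = h + 6 * (S1 * h) + 2 * (S2 * h) + G * h)//; ring.
have h1 : h <= 1 by lra.
have [h2 h3] : 0 <= h ^+ 2 /\ 0 <= h ^+ 3 by rewrite !exprn_ge0// ltW.
have K1h : 0 <= K1 * h ^+ 3 by rewrite mulr_ge0.
have K2h : 0 <= K2 * h ^+ 3 by rewrite mulr_ge0.
have E1le : E 1%N <= 2 * K2 * h ^+ 3.
  have [e1 _ _] := nonneg 1%N.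
  have : S2 * h * E 1%N <= 2^-1 * E 1%N by rewrite ler_wpM2r//; lra.
  lra.
have D0le : h^-1 * E 1%N <= 2 * K2 * h ^+ 2.
  by rewrite ler_pdivrMl// mulrCA -exprS.
have Qle n : n.+1%:R * h <= T -> E n <= 1 -> E n.+1 <= 1 ->
    Q n <= 3 * (S1 * h) * (D n.+1 + D n + E n.+1) + K1 * h ^+ 3.
  move=> nT En En1; apply: le_trans (twostep n nT En En1) _.
  rewrite lerD2r (mulrC 3) -[leRHS]mulrA; apply: ler_wpM2l => //.
  have [_ i1 _] := incr n; have [i2 _ _] := incr n.+1.
  have [_ dn _] := nonneg n; have [en1 dn1 _] := nonneg n.+1.
  have := ler_piMl dn h1; have := ler_piMl dn1 h1; lra.
have Wle : forall n : nat, n%:R * h <= T -> E n + D n <= G * h ^+ 2.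
  apply: (@gronwall T K h) => //.
  - rewrite E0 add0r D0; apply: le_trans D0le _; rewrite ler_wpM2r// /K; lra.
  - move=> n nT Wn; have [en dn qn] := nonneg n; have [en1 dn1 _] := nonneg n.+1.
    have [i1 _ i3] := incr n.
    have Dh : h * D n <= D n by rewrite ler_piMl.
    have Qn : Q n <= 3 * (S1 * h) * (D n.+1 + D n + E n.+1) + K1 * h ^+ 3.
      by apply: Qle => //; lra.
    have k01 : 0 <= 3 * (S1 * h) <= 2^-1 by apply/andP; split; lra.
    have d1 : D n.+1 <= D n + 3 * (S1 * h) * (D n.+1 + D n + E n.+1) + K1 * h ^+ 3.
      lra.
    apply: le_trans (error_step (ltW h0) k01 en en1 dn dn1 K1h i1 d1) _.
    apply: lerD.
      apply: ler_wpM2r; first exact: addr_ge0.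
      have : 0 <= K1 * h by rewrite mulr_ge0// ltW.
      have : 0 <= K2 * h by rewrite mulr_ge0// ltW.
      by rewrite /K !mulrDl; lra.
    by rewrite mulrA ler_wpM2r// /K; lra.
  - by rewrite -/G expr2 mulrA; apply: mulr_ile1 => //; [exact: ltW|lra].
have Gh2 : G * h ^+ 2 <= 1.
  by rewrite expr2 mulrA; apply: mulr_ile1 => //; [exact: ltW|lra].
have Gh20 : 0 <= G * h ^+ 2 by rewrite mulr_ge0.
have Ele n : n%:R * h <= T -> E n.+1 <= G * h ^+ 2.
  move=> nT; have Wn := Wle n nT; have [i1 _ _] := incr n.
  have [_ dn _] := nonneg n; have := ler_piMl dn h1; lra.
have prev (n : nat) : n.+1%:R * h <= T -> n%:R * h <= T.
  by apply: le_trans; rewrite ler_pM2r// ler_nat.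
have Qfin n : n.+1%:R * h <= T -> Q n <= (9 * S1 * G + K1) * h ^+ 3.
  move=> nT; have W1 := Wle _ nT; have W0 := Wle _ (prev _ nT).
  have [en dn _] := nonneg n; have [en1 dn1 _] := nonneg n.+1.
  apply: (@le_trans _ _ (3 * (S1 * h) * (3 * (G * h ^+ 2)) + K1 * h ^+ 3)).
    apply: le_trans (Qle n nT _ _) _; [lra|lra|].
    by rewrite lerD2r ler_wpM2l//; lra.
  by rewrite le_eqVlt; apply/orP; left; apply/eqP; ring.
have f1le : f 1%N <= L * h ^+ 2.
  apply: le_trans f1 _; rewrite /L mulrDl lerD2r -mulrA.
  exact: ler_wpM2l.
(* Velocities are compared two indices apart, so the induction carries a pair. *)
have fle n : n%:R * h <= T ->
    f n <= L * h ^+ 2 + n%:R * (U * h ^+ 3) /\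
    f n.+1 <= L * h ^+ 2 + n%:R * (U * h ^+ 3).
  elim: n => [_|n IH nT].
    by rewrite f0 mul0r addr0; split => //; rewrite mulr_ge0.
  have [g0 g1] := IH (prev n nT).
  have Uh : 0 <= U * h ^+ 3 by rewrite mulr_ge0.
  split; first by apply: le_trans g1 _; rewrite lerD2l ler_wpM2r// ler_nat.
  apply: le_trans (fstep n nT) _.
  have S4Q := ler_wpM2l S40 (Qfin n nT).
  have UE : U * h ^+ 3 = S4 * ((9 * S1 * G + K1) * h ^+ 3) + K4 * h ^+ 3.
    by rewrite /U; ring.
  rewrite -natr1 [_ * (U * _)]mulrDl mul1r; lra.
move=> n nT; have TU : 0 <= T * U by rewrite mulr_ge0// ltW.
split.
  by apply: le_trans (Ele n nT) _; rewrite ler_wpM2r//; lra.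
apply: le_trans (fle n nT).2 _.
have : n%:R * (U * h ^+ 3) <= T * U * h ^+ 2.
  rewrite (_ : n%:R * _ = n%:R * h * (U * h ^+ 2)); last by ring.
  by rewrite -(mulrA T) ler_wpM2r// mulr_ge0.
rewrite !mulrDl => ?.
by have := mulr_ge0 G0 h2; lra.
Qed.

End discrete.

(** * Convergence *)

Section convergence.
Context {R : realType}.

Lemma norm_le_enorm (v : 'cV[R]_3) : `|v| <= enorm v.
Proof.
apply: mxnorm_le => [|i j]; first exact: sqrtr_ge0.
rewrite ord1 -sqrtr_sqr ler_wsqrtr// (bigD1 i)//= lerDl.
by apply: sumr_ge0 => k _; exact: sqr_ge0.
Qed.

Lemma enorm_le_norm (v : 'cV[R]_3) : enorm v <= 2 * `|v|.
Proof.
have n0 : 0 <= 2 * `|v| by rewrite mulr_ge0.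
rewrite -[leRHS](ger0_norm n0) -sqrtr_sqr ler_wsqrtr//.
apply: (@le_trans _ _ (\sum_(i < 3) `|v| ^+ 2)).
  apply: ler_sum => i _; rewrite -real_normK ?num_real// lerXn2r ?nnegrE//.
  exact: mxcoord_le_norm.
rewrite sumr_const card_ord exprMn -[leLHS]mulr_natl ler_wpM2r ?exprn_ge0//.
by rewrite -natrX ler_nat.
Qed.

Lemma FVI_convergence (T r : R) (B0 : 'cV[R]_3) (A F : 'cV[R]_3 -> 'cV[R]_3)
    (x : R -> 'cV[R]_3) :
  0 < T -> 0 <= r -> Ck 5 A -> Ck 5 F -> Ck 5 (x : R^o -> 'cV[R]_3) ->
  (forall t, 0 <= t <= T -> derive1n 2 x t =
    (Jac A (x t))^T *m derive1 x t - Jac A (x t) *m derive1 x t + F (x t)) ->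
  exists h0 C : R, [/\ 0 < h0, 0 < C & forall h, 0 < h <= h0 ->
    forall xn vn : nat -> 'cV[R]_3,
      FVI B0 A F T h (x 0) (derive1 x 0) xn vn ->
      (forall n : nat, n%:R * h <= T -> `|xn n.+1 - xn n| <= r) ->
      forall n : nat, n%:R * h <= T ->
        `|xn n.+1 - x (n.+1%:R * h)| <= C * h ^+ 2 /\
        `|vn n.+1 - derive1 x (n.+1%:R * h)| <= C * h ^+ 2].
Proof.
move=> T0 r0 HA HF Hx ode.
have [S1 [K1 [S10 K10 H1]]] := two_step_error B0 HA HF Hx ode r0.
have [S2 [K2 [S20 K20 H2]]] := start_error B0 T0 HA HF Hx ode r0.
have [S3 [K3 [S30 K30 H3]]] := velocity_start_error B0 T0 Hx.
have [S4 [K4 [S40 K40 H4]]] := velocity_error T B0 Hx.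
have [h0 [C [/andP[h00 h01] C0 HC]]] :=
  discrete_convergence T0 S10 K10 S20 K20 S30 K30 S40 K40.
exists h0, C; split=> // h hh xn vn [xn0 vn0 st step vel] near_x n nT.
have /andP[hp hh0] := hh.
have hh1 : 0 < h <= 1 by rewrite hp (le_trans hh0).
have hi0 : 0 <= h^-1 by rewrite invr_ge0 ltW.
pose e k := xn k - x (k%:R * h).
have xnE k : xn k = e k + x (k%:R * h) by rewrite /e subrK.
pose g k := vn k - derive1 x (k%:R * h).
have tS k : k.+1%:R * h = k%:R * h + h by rewrite -natr1 mulrDl mul1r.
have tB k : k%:R * h = k.+1%:R * h - h by rewrite tS addrK.
have prev (k : nat) : k.+1%:R * h <= T -> k%:R * h <= T.
  by apply: le_trans; rewrite ler_pM2r// ler_nat.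
rewrite -[xn n.+1 - _]/(e n.+1) -[vn n.+1 - _]/(g n.+1).
have e0 : e 0%N = 0 by rewrite /e mul0r xn0 subrr.
have g0 : g 0%N = 0 by rewrite /g mul0r vn0 subrr.
apply: (HC h hh (fun k => `|e k|) (fun k => h^-1 * `|e k.+1 - e k|)
  (fun k => h^-1 * `|e k.+2 - 2 *: e k.+1 + e k|) (fun k => `|g k|)) => //.
- by move=> k; split; rewrite ?mulr_ge0.
- move=> k; rewrite mulVKf ?gt_eqF//; split.
  + by rewrite addrC -lerBlDr; exact: lerB_dist.
  + by rewrite addrC -lerBlDr (distrC (e k.+1)); exact: lerB_dist.
  + rewrite -mulrDr ler_wpM2l//; apply: le_trans (ler_normD _ _).
    rewrite le_eqVlt; apply/orP; left; apply/eqP; congr (`|_|).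
    by move: (e k) (e k.+1) (e k.+2) => *; apply/matrixP => i j; rewrite !mxE; ring.
- by rewrite e0 normr0.
- by rewrite g0 normr0.
- by rewrite e0 subr0.
- have := H2 h (xn 1%N) hh1; rewrite xn0 vn0 in st => /(_ st).
  rewrite -[in `|_ - x 0|]xn0 => /(_ (near_x 0%N _)).
  by rewrite mul0r (ltW T0) => /(_ isT); rewrite /e mul1r.
- move=> k kT ek ek1; have := H1 h (k.+1%:R * h) (xn k) (xn k.+1) (xn k.+2) hh1.
  rewrite kT tS lerDr mulr_ge0 ?ler0n ?(ltW hp)// addrK -[k%:R * h + h]tS.
  rewrite -tS => /(_ isT (step k.+1 isT kT) ek ek1 (near_x _ kT)) Hk.
  apply: le_trans (ler_wpM2l hi0 Hk) _.
  rewrite -/(e k) -/(e k.+1) -/(e k.+2) le_eqVlt; apply/orP; left; apply/eqP.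
  by field; rewrite gt_eqF.
- have := H3 h (xn 1%N) (vn 1%N) hh1; have := vel 0%N.
  rewrite mul0r (ltW T0) xn0 vn0 => /(_ isT) v1 /(_ v1).
  by rewrite /g /e !mul1r.
- move=> k kT; have := H4 h (k.+1%:R * h) (xn k) (xn k.+1) (xn k.+2)
    (vn k) (vn k.+1) (vn k.+2) hh1.
  rewrite kT mulr_ge0 ?ler0n ?(ltW hp)// => /(_ isT (vel k (prev k kT)) (vel k.+1 kT)).
  rewrite -tB -tS -/(e k) -/(e k.+1) -/(e k.+2) -/(g k) -/(g k.+2) => Hk.
  have gk : `|g k.+2| <= `|g k| + `|g k.+2 - g k|.
    by rewrite -lerBlDl; exact: lerB_dist.
  by apply: le_trans gk _; rewrite -[leRHS]addrA; exact: lerD (lexx _) Hk.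
Qed.

End convergence.

Theorem theorem3p1 (R : realType) :
  exists k : nat,
  forall (T Chat c : R) (L : R -> R)
         (B0 : 'cV[R]_3) (A1 B1 F : 'cV[R]_3 -> 'cV[R]_3)
         (x : R -> 'cV[R]_3),
  let A := potential B0 A1 in
  let B := fun y => B0 + B1 y in
  0 < T -> 0 < c ->
  enorm B0 = 1 ->
  (forall y, B1 y = curl A1 y) ->
  ~ (exists b, forall y, B1 y = b) ->
  bounded_field B1 -> bounded_field F ->
  Ck k B1 -> Ck k A -> Ck k F ->
  locally_lipschitz L A -> locally_lipschitz L F ->
  Ck k (x : R^o -> 'cV[R]_3) ->
  solves_CPD T B F x ->
  enorm (x 0) <= Chat -> enorm (derive1 x 0) <= Chat ->
  forall r : R, 0 < r ->
  exists h0 C : R, [/\ 0 < h0, 0 < C &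
    forall h : R, 0 < h <= h0 -> c <= `|cos (h / 2)| ->
    forall xn vn : nat -> 'cV[R]_3,
      FVI B0 A F T h (x 0) (derive1 x 0) xn vn ->
      solved_within r T h xn ->
      forall n : nat, n%:R * h <= T ->
        enorm (xn n.+1 - x (n.+1%:R * h)) <= C * h ^+ 2 /\
        enorm (vn n.+1 - derive1 x (n.+1%:R * h)) <= C * h ^+ 2].
Proof.
exists 5%N => T Chat c L B0 A1 B1 F x A B T0 c0 nB0 B1E _ _ _ _ HA HF _ _ Hx sol _ _ r r0.
have ode t : 0 <= t <= T -> derive1n 2 x t =
    (Jac A (x t))^T *m derive1 x t - Jac A (x t) *m derive1 x t + F (x t).
  move=> tt; rewrite sol// /B B1E lorentz_curl curl_potential//.
  exact: Ck_differentiable HA _.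
have [h0 [C [h00 C0 HC]]] := FVI_convergence B0 T0 (ltW r0) HA HF Hx ode.
exists h0, (2 * C); split=> [//||h hh _ xn vn method within n nT].
  by rewrite mulr_gt0.
have [|e1 e2] := HC h hh xn vn method _ n nT.
  by move=> k kT; exact: le_trans (norm_le_enorm _) (within k kT).
have two v : `|v| <= C * h ^+ 2 -> enorm v <= 2 * C * h ^+ 2.
  by move=> vC; apply: le_trans (enorm_le_norm _) _; rewrite -mulrA ler_wpM2l.
by split; exact: two.
Qed.
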